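(* Let $G$ be either (i) a symmetric subgroup of $\mathrm{GL}_m(\mathbb{C})\times\mathrm{GL}_n(\mathbb{C})$ with $T_m(\mathbb{C})\times T_n(\mathbb{C})\le G$, or (ii) a symmetric subgroup of $\mathrm{GL}_m(\mathbb{C})$ with $T_m(\mathbb{C})\le G$ (in this case write $Y=I_n$ below). Let $A\in\mathbb{C}^{m\times n}$ and $B\in\mathbb{C}^{n\times m}$ be nonzero, let $\kappa_F(A',B')=\|A'\|_F\|B'\|_F$, let $\kappa_F^\star=\inf_{(X,Y)\in G}\kappa_F(XAY^{-1},YBX^{-1})$, and let $C_{A,B}(K(X,Y))=\log\|XAY^{-1}\|_F+\log\|YBX^{-1}\|_F$. Consider the gradient descent iteration $(X_0,Y_0)=(I_m,I_n)$, $(X_{k+1},Y_{k+1})=(e^{-\eta H_k}X_k,e^{-\eta H'_k}Y_k)$ with $(H_k,H_k')=\nabla C_{A,B}(K(X_k,Y_k))$ and $\eta=1/8$. There is an absolute constant $c>0$ such that for every $0<\varepsilon<1/2$ and every integer $T\ge c\,\max(m^3,n^3)\log(\kappa_F(A,B)/\kappa_F^\star)/\varepsilon^2$, one has $\log\kappa_F(X_TAY_T^{-1},Y_TBX_T^{-1})-\log\kappa_F^\star<\varepsilon$.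
   Context: $T_m(\mathbb{C})$ is the group of invertible diagonal $m\times m$ matrices. A subgroup is symmetric if it is Zariski closed and closed under conjugate transposition. $K=G\cap(\mathrm{U}_m\times\mathrm{U}_n)$ (resp. $G\cap\mathrm{U}_m$); $\mathrm{Lie}(G)=\{(H_1,H_2):(e^{tH_1},e^{tH_2})\in G\ \forall t\}$; $i\mathrm{Lie}(K)$ is the set of Hermitian pairs in $\mathrm{Lie}(G)$. The gradient $\nabla f(Kg)\in i\mathrm{Lie}(K)$ of smooth $f$ on the right coset space $G/K$ is defined by $\langle\nabla f(Kg),H\rangle=\frac{d}{dt}|_{t=0}f(Ke^{tH}g)$ for all $H\in i\mathrm{Lie}(K)$, with $\langle(H_1,H_2),(H_3,H_4)\rangle=\mathrm{Re}(\mathrm{tr}(H_1^*H_3)+\mathrm{tr}(H_2^*H_4))$ and $e^{tH}(X,Y)=(e^{tH_1}X,e^{tH_2}Y)$. *)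

(* Defs.v *)
From HB Require Import structures.
From mathcomp Require Import all_boot all_order all_algebra.
From mathcomp Require Import all_classical all_reals all_analysis.
From mathcomp Require Import complex.
From mathcomp Require mpoly.

Set Implicit Arguments.
Unset Strict Implicit.
Unset Printing Implicit Defensive.

Import Order.TTheory GRing.Theory Num.Theory numFieldNormedType.Exports.
Local Open Scope ring_scope.
Local Open Scope classical_set_scope.

Section Defs.
Variable R : realType.
Local Notation C := R[i].

Definition rC (t : R) : C := Complex t 0.

Definition adj_mx (p q : nat) (M : 'M[C]_(p, q)) : 'M[C]_(q, p) :=
  map_mx (@conjc R) M^T.

Definition hermitian (p : nat) (H : 'M[C]_p) : Prop := adj_mx H = H.

Definition expmx_partial (p : nat) (H : 'M[C]_p) (N : nat) : 'M[C]_p :=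
  \sum_(k < N) (rC (k`!%:R)^-1 *: (H ^+ k)).

Definition expmx (p : nat) (H : 'M[C]_p) : 'M[C]_p :=
  \matrix_(i, j)
    Complex (limn (fun N => complex.Re (expmx_partial H N i j)))
            (limn (fun N => complex.Im (expmx_partial H N i j))).

Definition frob (p q : nat) (M : 'M[C]_(p, q)) : R :=
  Num.sqrt (\sum_i \sum_j ((complex.Re (M i j)) ^+ 2 + (complex.Im (M i j)) ^+ 2)).

Definition kappaF (m n : nat) (A' : 'M[C]_(m, n)) (B' : 'M[C]_(n, m)) : R :=
  frob A' * frob B'.

Definition torus (p : nat) : set 'M[C]_p :=
  [set D : 'M[C]_p | (forall i j : 'I_p, i != j -> D i j = 0) /\ D \in unitmx].

Definition GLpair (m n : nat) : set ('M[C]_m * 'M[C]_n) :=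
  [set g | g.1 \in unitmx /\ g.2 \in unitmx].

Definition is_subgroup (m n : nat) (G : set ('M[C]_m * 'M[C]_n)) : Prop :=
  [/\ G `<=` @GLpair m n,
      G (1%:M, 1%:M),
      (forall g h, G g -> G h -> G (g.1 *m h.1, g.2 *m h.2)) &
      (forall g, G g -> G (invmx g.1, invmx g.2))].

Definition coords (m n : nat) (g : 'M[C]_m * 'M[C]_n) : 'I_(m * m + n * n) -> C :=
  fun k => row_mx (mxvec g.1) (mxvec g.2) 0 k.

Definition zariski_closed (m n : nat) (G : set ('M[C]_m * 'M[C]_n)) : Prop :=
  exists S : set (mpoly.mpoly (m * m + n * n) C),
    G = [set g | GLpair g /\ forall P, S P -> mpoly.meval (coords g) P = 0].

Definition symmetric_subgroup (m n : nat) (G : set ('M[C]_m * 'M[C]_n)) : Prop :=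
  [/\ is_subgroup G, zariski_closed G &
      forall g, G g -> G (adj_mx g.1, adj_mx g.2)].

Definition LieG (m n : nat) (G : set ('M[C]_m * 'M[C]_n)) : set ('M[C]_m * 'M[C]_n) :=
  [set H | forall t : R, G (expmx (rC t *: H.1), expmx (rC t *: H.2))].

Definition iLieK (m n : nat) (G : set ('M[C]_m * 'M[C]_n)) : set ('M[C]_m * 'M[C]_n) :=
  [set H | LieG G H /\ hermitian H.1 /\ hermitian H.2].

Definition ip (m n : nat) (H H' : 'M[C]_m * 'M[C]_n) : R :=
  complex.Re (\tr (adj_mx H.1 *m H'.1) + \tr (adj_mx H.2 *m H'.2)).

Definition act (m n : nat) (t : R) (H g : 'M[C]_m * 'M[C]_n) : 'M[C]_m * 'M[C]_n :=
  (expmx (rC t *: H.1) *m g.1, expmx (rC t *: H.2) *m g.2).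

Definition is_gradient (m n : nat) (G : set ('M[C]_m * 'M[C]_n))
  (f : 'M[C]_m * 'M[C]_n -> R) (g D : 'M[C]_m * 'M[C]_n) : Prop :=
  iLieK G D /\
  forall H, iLieK G H -> is_derive (0 : R) (1 : R) (fun t => f (act t H g)) (ip D H).

(* the gradient (chosen element satisfying the defining property; it is unique) *)
Definition gradient (m n : nat) (G : set ('M[C]_m * 'M[C]_n))
  (f : 'M[C]_m * 'M[C]_n -> R) (g : 'M[C]_m * 'M[C]_n) : 'M[C]_m * 'M[C]_n :=
  xget (0, 0) (is_gradient G f g).

Definition costAB (m n : nat) (A : 'M[C]_(m, n)) (B : 'M[C]_(n, m))
  (g : 'M[C]_m * 'M[C]_n) : R :=
  ln (frob (g.1 *m A *m invmx g.2)) + ln (frob (g.2 *m B *m invmx g.1)).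

Definition kappa_at (m n : nat) (A : 'M[C]_(m, n)) (B : 'M[C]_(n, m))
  (g : 'M[C]_m * 'M[C]_n) : R :=
  kappaF (g.1 *m A *m invmx g.2) (g.2 *m B *m invmx g.1).

Definition kappa_star (m n : nat) (G : set ('M[C]_m * 'M[C]_n))
  (A : 'M[C]_(m, n)) (B : 'M[C]_(n, m)) : R :=
  inf [set kappa_at A B g | g in G].

Fixpoint gd (m n : nat) (G : set ('M[C]_m * 'M[C]_n))
  (A : 'M[C]_(m, n)) (B : 'M[C]_(n, m)) (eta : R) (k : nat) : 'M[C]_m * 'M[C]_n :=
  match k with
  | 0 => (1%:M, 1%:M)
  | k'.+1 =>
      let g := gd G A B eta k' in
      let D := gradient G (costAB A B) g in
      (expmx (rC (- eta) *: D.1) *m g.1, expmx (rC (- eta) *: D.2) *m g.2)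
  end.

End Defs.

(* Main.v *)
(** Along [exp (t H)], with [H = U^* diag(x) U] and [H' = V^* diag(y) V], the cost is a sum of two
    log-sum-exps in the differences [x_i - y_j].  Because [G] contains the maximal torus, the
    Hermitian part of [Lie(G)] consists of all Hermitian pairs supported on an equivalence relation
    of indices (the root spaces of [G]); hence it is stable under functional calculus.

    Descent.  The gradient has norm at most [2], and [e^u <= 1 + u + 4/5 u^2] for [|u| <= 3/4]
    shows that one step of size [1/8] decreases the cost by at least [|grad|^2 / 40].

    Gap.  By the polar decomposition a competitor is [k exp(H) g] with [k] unitary and [H] in
    [iLie(K)].  Shrinking to length [1] the gaps longer than [1] between consecutive eigenvalues
    gives [T] in [iLie(K)] with [|T|^2 <= (m+n)^3], and [1 + t <= e^t] yields
    [kappa(exp(H) g) / kappa(g) >= 1 + <grad, T> / 2].  So a gap of at least [eps] forces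
    [|grad|^2 >= eps^2 / (m+n)^3], and telescoping the descent bounds the number of such steps. *)
Require Import Defs.
From HB Require Import structures.
From mathcomp Require Import all_boot all_order all_algebra.
From mathcomp Require Import all_classical all_reals all_analysis.
From mathcomp Require Import complex zify ring lra.

Set Implicit Arguments.
Unset Strict Implicit.
Unset Printing Implicit Defensive.

Import Order.TTheory GRing.Theory Num.Theory numFieldNormedType.Exports.
Local Open Scope ring_scope.
Local Open Scope classical_set_scope.

(** A competitor is reached along [exp(H)] with [H] of arbitrary length, so convexity along that
    geodesic bounds the gradient only by the gap divided by [|H|]. Truncating the spectrum removes
    this loss, but the truncating function depends on the spectrum and is not linear: its value at
    [H] lies in [iLie(K)] only because membership there is a support condition on the entries, which
    polynomials in [H] respect. The torus supplies this condition. Conjugation by it isolates single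
    entries of [H], and together with the transvections so obtained it generates every invertible
    matrix with the right support. Case (ii) shapes the details. There the second component of
    [iLie(K)] is zero, encoded by the empty relation on indices; a function applied to that
    component must vanish at [0]. Hence the truncation is normalised at [0], and the shift that
    balances the two sums is put on the first component, whose relation is reflexive. All
    exponentials are evaluated in an orthonormal eigenbasis, where they become scalar
    exponentials. *)

HB.instance Definition _ (R : realType) := GRing.RMorphism.copy (@rC R) (real_complex R).

Lemma hermitian_diagonalization (C : numClosedFieldType) (p : nat) (A : 'M[C]_p) :
  map_mx Num.conj A^T = A ->
  exists (U : 'M[C]_p) (d : 'rV[C]_p), [/\ U *m map_mx Num.conj U^T = 1%:M,
    forall i, d 0 i \is Num.real & A = map_mx Num.conj U^T *m diag_mx d *m U].
Proof.
move=> hA; have hs : A \is hermsymmx.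
  by apply/is_hermitianmxP; rewrite expr0 scale1r hA.
have /hermitian_normalmx/orthomx_spectralP e := hs.
have /mxOverP hr := hermitian_spectral_diag_real hs.
have u := spectral_unitarymx A.
exists (spectralmx A), (spectral_diag A); split=> //; first exact/unitarymxP.
by rewrite {1}e invmx_unitary.
Qed.

(** * Hermitian matrices and their exponentials *)

Section Spec.
Variable R : realType.
Local Notation C := R[i].

Lemma conjc_rC (t : R) : conjc (rC t) = rC t.
Proof. by rewrite /rC /= oppr0. Qed.

Lemma conjcMn (z : C) n : conjc (z *+ n) = conjc z *+ n.
Proof. exact: rmorphMn. Qed.

Lemma cRe_sum (I : Type) (r : seq I) (P : pred I) (F : I -> C) :
  complex.Re (\sum_(i <- r | P i) F i) = \sum_(i <- r | P i) complex.Re (F i).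
Proof. by elim/big_rec2: _ => // i a b _ <-; case: (F i) b => ? ? []. Qed.

Lemma cIm_sum (I : Type) (r : seq I) (P : pred I) (F : I -> C) :
  complex.Im (\sum_(i <- r | P i) F i) = \sum_(i <- r | P i) complex.Im (F i).
Proof. by elim/big_rec2: _ => // i a b _ <-; case: (F i) b => ? ? []. Qed.

Lemma cReM_rC (z : C) (t : R) : complex.Re (z * rC t) = complex.Re z * t.
Proof. by case: z => a b /=; rewrite mulr0 subr0. Qed.

Lemma cImM_rC (z : C) (t : R) : complex.Im (z * rC t) = complex.Im z * t.
Proof. by case: z => a b /=; rewrite mulr0 add0r. Qed.

Lemma cReM (z w : C) : complex.Re (z * w) =
  complex.Re z * complex.Re w - complex.Im z * complex.Im w.
Proof. by case: z w => [a b] [c d]. Qed.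

Lemma cImM (z w : C) : complex.Im (z * w) =
  complex.Re z * complex.Im w + complex.Im z * complex.Re w.
Proof. by case: z w => [a b] [c d]. Qed.

Lemma complex_eqP (z w : C) :
  complex.Re z = complex.Re w -> complex.Im z = complex.Im w -> z = w.
Proof. by case: z w => [a b] [c d] /= -> ->. Qed.

Lemma adj_mxE p q (M : 'M[C]_(p, q)) i j : adj_mx M i j = conjc (M j i).
Proof. by rewrite !mxE. Qed.

Lemma adj_mxK p q (M : 'M[C]_(p, q)) : adj_mx (adj_mx M) = M.
Proof. by apply/matrixP=> i j; rewrite !adj_mxE conjcK. Qed.

Lemma adj_mxM p q r (M : 'M[C]_(p, q)) (N : 'M[C]_(q, r)) :
  adj_mx (M *m N) = adj_mx N *m adj_mx M.
Proof. by rewrite /adj_mx trmx_mul map_mxM. Qed.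

Lemma adj_mxD p q (M N : 'M[C]_(p, q)) : adj_mx (M + N) = adj_mx M + adj_mx N.
Proof. by apply/matrixP=> i j; rewrite !(adj_mxE, mxE) rmorphD. Qed.

Lemma adj_mxB p q (M N : 'M[C]_(p, q)) : adj_mx (M - N) = adj_mx M - adj_mx N.
Proof. by apply/matrixP=> i j; rewrite !(adj_mxE, mxE) rmorphB. Qed.

Lemma adj_mxZ p q a (M : 'M[C]_(p, q)) : adj_mx (a *: M) = conjc a *: adj_mx M.
Proof. by apply/matrixP=> i j; rewrite !(adj_mxE, mxE) rmorphM. Qed.

Lemma adj_mx1 p : adj_mx (1%:M : 'M[C]_p) = 1%:M.
Proof. by apply/matrixP=> i j; rewrite !(adj_mxE, mxE) eq_sym rmorph_nat. Qed.

Definition unitary p (U : 'M[C]_p) := adj_mx U *m U = 1%:M.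

Lemma unitaryV p (U : 'M[C]_p) : unitary U -> U *m adj_mx U = 1%:M.
Proof. by move/mulmx1C. Qed.

(** For a fixed unitary [U] these matrices form a copy of the algebra of real functions on the
    indices. Products, powers, exponentials and inverses are thus computed on [x] alone. *)
Definition spec p (U : 'M[C]_p) (x : 'I_p -> R) : 'M[C]_p :=
  adj_mx U *m diag_mx (\row_i rC (x i)) *m U.

Lemma specE p (U : 'M[C]_p) x a b :
  spec U x a b = \sum_l conjc (U l a) * U l b * rC (x l).
Proof.
rewrite /spec mul_mx_diag !mxE; apply: eq_bigr => l _.
by rewrite !mxE mulrAC.
Qed.

Lemma eq_spec p (U : 'M[C]_p) x y : x =1 y -> spec U x = spec U y.
Proof. by move=> e; congr spec; apply/funext. Qed.

Lemma hermitian_spec p (H : 'M[C]_p) : Defs.hermitian H ->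
  exists (U : 'M[C]_p) (x : 'I_p -> R), unitary U /\ H = spec U x.
Proof.
move=> hH; have [|U [d [hU hd e]]] := @hermitian_diagonalization C p H.
  by rewrite -[RHS]hH; apply/matrixP => i j; rewrite !mxE.
have ad : map_mx Num.conj U^T = adj_mx U by apply/matrixP => i j; rewrite !mxE.
rewrite ad in hU e.
exists U, (fun i => complex.Re (d 0 i)); split; first exact: mulmx1C.
rewrite e /spec; congr (_ *m diag_mx _ *m _); apply/matrixP => i j.
by rewrite !mxE ord1; have /complex_realP[k ->] := hd j.
Qed.

Lemma diag_rC p (x : 'I_p -> R) :
  adj_mx (diag_mx (\row_i rC (x i)) : 'M[C]_p) = diag_mx (\row_i rC (x i)).
Proof.
apply/matrixP => i j; rewrite adj_mxE !mxE conjcMn conjc_rC.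
by case: eqVneq => [->|].
Qed.

Lemma spec_herm p (U : 'M[C]_p) x : Defs.hermitian (spec U x).
Proof. by rewrite /Defs.hermitian /spec !adj_mxM adj_mxK diag_rC mulmxA. Qed.

Lemma spec_mul p (U : 'M[C]_p) x y : unitary U ->
  spec U x *m spec U y = spec U (fun i => x i * y i).
Proof.
move=> /unitaryV hU; rewrite /spec !mulmxA -[_ *m U *m adj_mx U]mulmxA hU mulmx1.
rewrite -[_ *m diag_mx _ *m diag_mx _]mulmxA; congr (_ *m _ *m _).
rewrite mul_diag_mx; apply/matrixP => i j; rewrite !mxE.
by case: eqVneq => [->|]; rewrite /= ?mulr1n ?mulr0n ?mulr0 // rmorphM.
Qed.

Lemma spec1 p (U : 'M[C]_p) : unitary U -> spec U (fun _ => 1) = 1%:M.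
Proof.
move=> hU; rewrite /spec (_ : diag_mx _ = 1%:M) ?mulmx1 //.
by apply/matrixP => i j; rewrite !mxE.
Qed.

Lemma specD p (U : 'M[C]_p) x y :
  spec U x + spec U y = spec U (fun i => x i + y i).
Proof.
apply/matrixP => i j; rewrite mxE !specE -big_split /=.
by apply: eq_bigr => l _; rewrite -mulrDr -rmorphD.
Qed.

Lemma specZ p (U : 'M[C]_p) c x :
  rC c *: spec U x = spec U (fun i => c * x i).
Proof.
apply/matrixP => i j; rewrite mxE !specE mulr_sumr.
by apply: eq_bigr => l _; rewrite rmorphM; ring.
Qed.

Lemma spec_exp p (U : 'M[C]_p) x k : unitary U ->
  spec U x ^+ k = spec U (fun i => x i ^+ k).
Proof.
move=> hU; elim: k => [|k IH]; first by rewrite (eq_spec _ (fun i => expr0 (x i))) spec1.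
rewrite exprS IH; apply: etrans (spec_mul _ _ hU) _.
by apply: eq_spec => i; rewrite exprS.
Qed.

Lemma spec_sum p (U : 'M[C]_p) (I : Type) (r : seq I) (x : I -> 'I_p -> R) :
  \sum_(k <- r) spec U (x k) = spec U (fun i => \sum_(k <- r) x k i).
Proof.
elim: r => [|k r IH].
  rewrite big_nil; apply/matrixP => i j; rewrite specE !mxE big1 // => l _.
  by rewrite big_nil rmorph0 mulr0.
by rewrite big_cons IH specD; apply: eq_spec => i; rewrite big_cons.
Qed.

(** Each partial sum is diagonal in the same basis, so its entries are fixed linear combinations of
    scalar exponential series. Real and imaginary parts are treated apart, to match the definition
    of [expmx]. *)
Lemma expmx_spec p (U : 'M[C]_p) x : unitary U ->
  expmx (spec U x) = spec U (fun i => expR (x i)).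
Proof.
move=> hU.
have part N : expmx_partial (spec U x) N =
    spec U (fun i => series (exp_coeff (x i)) N).
  rewrite /expmx_partial -(big_mkord xpredT (fun k => rC k`!%:R^-1 *: spec U x ^+ k)).
  rewrite (eq_bigr (fun k => spec U (fun i => exp_coeff (x i) k))); last first.
    move=> k _; rewrite spec_exp // specZ; apply: eq_spec => i.
    by rewrite /exp_coeff /= mulrC.
  by rewrite spec_sum; apply: eq_spec => i; rewrite /series /=.
have cvs l : series (exp_coeff (x l)) @ \oo --> expR (x l).
  by apply: is_cvg_series_exp_coeff.
have lims (c : 'I_p -> R) : limn (fun N => \sum_l c l * series (exp_coeff (x l)) N) =
    \sum_l c l * expR (x l).
  apply: cvg_lim => //.
  apply: cvg_big; first exact: add_continuous.
  by move=> l _; apply: cvgM => //; apply: cvg_cst.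
apply/matrixP => a b; rewrite mxE specE; apply: complex_eqP => /=.
  rewrite cRe_sum (eq_bigr _ (fun l _ => cReM_rC _ _)) -lims; congr (limn _).
  by apply/funext => N; rewrite part specE cRe_sum (eq_bigr _ (fun l _ => cReM_rC _ _)).
rewrite cIm_sum (eq_bigr _ (fun l _ => cImM_rC _ _)) -lims; congr (limn _).
by apply/funext => N; rewrite part specE cIm_sum (eq_bigr _ (fun l _ => cImM_rC _ _)).
Qed.

Lemma expmx_specZ p (U : 'M[C]_p) x t : unitary U ->
  expmx (rC t *: spec U x) = spec U (fun i => expR (t * x i)).
Proof. by move=> hU; rewrite specZ expmx_spec. Qed.

Lemma spec_unit p (U : 'M[C]_p) x : unitary U -> (forall i, x i != 0) ->
  spec U x \in unitmx /\ invmx (spec U x) = spec U (fun i => (x i)^-1).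
Proof.
move=> hU hx.
have h : spec U x *m spec U (fun i => (x i)^-1) = 1%:M.
  by rewrite spec_mul // -(spec1 hU); apply: eq_spec => i; rewrite mulfV.
have [u _] := mulmx1_unit h; split=> //.
by rewrite -[RHS](mulKmx u) h mulmx1.
Qed.

End Spec.

(** * Matrices supported on an equivalence relation *)

Section Mask.
Variable R : realType.
Local Notation C := R[i].

Definition masked p (r : 'I_p -> 'I_p -> Prop) (M : 'M[C]_p) : Prop :=
  forall i j, M i j != 0 -> r i j.

Lemma maskedP0 p r (M : 'M[C]_p) i j : masked r M -> ~ r i j -> M i j = 0.
Proof. by move=> h nr; apply/eqP/negP => /negP /h. Qed.

Lemma masked0 p r : masked r (0 : 'M[C]_p).
Proof. by move=> i j; rewrite mxE eqxx. Qed.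

Lemma masked1 p r : (forall i, r i i) -> masked r (1%:M : 'M[C]_p).
Proof. by move=> h i j; rewrite mxE; have [->|] := eqVneq i j; rewrite ?eqxx. Qed.

Lemma maskedD p r (M N : 'M[C]_p) : masked r M -> masked r N -> masked r (M + N).
Proof.
move=> hM hN i j; rewrite mxE; have [->|/hM //] := eqVneq (M i j) 0.
by rewrite add0r => /hN.
Qed.

Lemma maskedZ p r c (M : 'M[C]_p) : masked r M -> masked r (c *: M).
Proof. by move=> hM i j; rewrite mxE mulf_eq0 negb_or => /andP[_ /hM]. Qed.

Lemma maskedM p r (M N : 'M[C]_p) : (forall i j k, r i j -> r j k -> r i k) ->
  masked r M -> masked r N -> masked r (M *m N).
Proof.
move=> tr hM hN i j; rewrite mxE => /eqP h; apply: contrapT => nr; apply: h.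
rewrite big1 // => k _; apply/eqP; rewrite mulf_eq0.
have [//|/hM rik] := eqVneq (M i k) 0; have [//|/hN rkj] := eqVneq (N k j) 0.
by case: nr; apply: tr rik rkj.
Qed.

(** Newton interpolation: a multiple of the polynomial vanishing at the earlier nodes corrects the
    value at a new one. No regularity of [f] is asked, so even a discontinuous function of a matrix
    is a polynomial in it. *)
Lemma poly_interpolation (F : fieldType) (s : seq F) (f : F -> F) :
  exists q : {poly F}, {in s, forall x, q.[x] = f x}.
Proof.
elim: s => [|x s [q hq]]; first by exists 0.
have [xs|xs] := boolP (x \in s).
  by exists q => y; rewrite inE => /orP[/eqP ->|]; apply: hq.
pose w : {poly F} := \prod_(y <- s) ('X - y%:P).
have wx : w.[x] != 0 by rewrite -/(root w x) root_prod_XsubC.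
exists (q + ((f x - q.[x]) / w.[x]) *: w) => y; rewrite inE hornerD hornerZ.
case/orP => [/eqP ->|ys]; first by rewrite divfK // addrC subrK.
have /rootP -> : root w y by rewrite root_prod_XsubC.
by rewrite mulr0 addr0 hq.
Qed.

(** With [f 0 = 0] the interpolating polynomial has no constant term, so only positive powers of the
    matrix occur and [r] may fail to be reflexive. This covers the empty relation. *)
Lemma masked_spec0 p r (U : 'M[C]_p) x (f : R -> R) :
  (forall i j k, r i j -> r j k -> r i k) -> unitary U -> f 0 = 0 ->
  masked r (spec U x) -> masked r (spec U (f \o x)).
Proof.
move=> tr hU f0 hx.
(* The extra node [0] forces the constant coefficient to vanish. *)
have [q hq] := poly_interpolation (0 :: [seq x i | i : 'I_p]) f.
have q0 : q`_0 = 0 by rewrite -horner_coef0 hq ?mem_head.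
have hpow k : masked r (spec U (fun i => x i ^+ k.+1)).
  elim: k => [|k IH]; first by rewrite (eq_spec _ (fun i => expr1 (x i))).
  rewrite (@eq_spec _ _ _ _ (fun i => x i * x i ^+ k.+1)); last by move=> i; rewrite -exprS.
  by rewrite -spec_mul //; apply: maskedM.
have -> : spec U (f \o x) = \sum_(k < size q) rC q`_k *: spec U (fun i => x i ^+ k).
  rewrite (eq_bigr _ (fun k _ => specZ _ _ _)) spec_sum; apply: eq_spec => i.
  by rewrite /= -hq ?horner_coef // inE map_f ?orbT // mem_enum.
elim/big_ind: _ => //; [exact: masked0|by move=> *; apply: maskedD|].
move=> [[|k] hk] _; first by rewrite q0 rmorph0 scale0r; apply: masked0.
by apply: maskedZ; apply: hpow.
Qed.

Lemma masked_spec p r (U : 'M[C]_p) x (f : R -> R) :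
  (forall i j k, r i j -> r j k -> r i k) -> (forall i, r i i) -> unitary U ->
  masked r (spec U x) -> masked r (spec U (f \o x)).
Proof.
move=> tr rr hU hx.
rewrite (_ : spec U _ = spec U ((fun t => f t - f 0) \o x) + rC (f 0) *: spec U (fun=> 1)).
  apply: maskedD; last by apply: maskedZ; rewrite spec1 //; apply: masked1.
  by apply: masked_spec0 => //; rewrite subrr.
by rewrite specZ specD; apply: eq_spec => i /=; rewrite mulr1 subrK.
Qed.

(** * Generating block-supported invertible matrices by transvections and the torus *)

Section Factor.
Variables (p : nat) (Q : 'M[C]_p -> Prop).
Hypotheses (Qu : forall X, Q X -> X \in unitmx)
  (QM : forall X Y, Q X -> Q Y -> Q (X *m Y))
  (Qadj : forall X, Q X -> Q (adj_mx X))
  (Qtorus : forall D, torus D -> Q D).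

Definition transv (i j : 'I_p) (z : C) : 'M[C]_p := 1%:M + z *: delta_mx i j.

(** Off the diagonal this records the roots of [Q]: the whole root subgroup at [(i, j)] lies in
    [Q]. *)
Definition blk (i j : 'I_p) : Prop := i = j \/ forall z, Q (transv i j z).

Lemma blk_refl i : blk i i. Proof. by left. Qed.

Lemma blk_sym i j : blk i j -> blk j i.
Proof.
case=> [->|h]; first by left.
right => z; have := Qadj (h (conjc z)); rewrite /transv adj_mxD adj_mx1 adj_mxZ conjcK.
congr (Q (_ + _ *: _)); apply/matrixP => a b.
by rewrite adj_mxE !mxE rmorph_nat andbC.
Qed.

(** The commutator of [transv i j z] and [transv j k 1] is [transv i k z] for distinct indices. *)
Lemma blk_trans i j k : blk i j -> blk j k -> blk i k.
Proof.
case=> [->//|hij] [<-|hjk]; first by right.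
have [<-|nik] := eqVneq i k; first by left.
have [ij|nij] := eqVneq i j; first by rewrite ij; right.
have [jk|njk] := eqVneq j k; first by rewrite -jk; right.
right => z.
have := QM (QM (hij z) (hjk 1)) (QM (hij (- z)) (hjk (- 1))).
congr Q; rewrite /transv.
have e1 : (1%:M + z *: delta_mx i j) *m (1%:M + 1 *: delta_mx j k) =
   1%:M + z *: delta_mx i j + delta_mx j k + z *: delta_mx i k :> 'M[C]_p.
  rewrite mulmxDl !mulmxDr !mul1mx !mulmx1 scale1r -scalemxAl mul_delta_mx.
  by rewrite -!addrA; congr (_ + _); rewrite addrCA.
have e2 : (1%:M + - z *: delta_mx i j) *m (1%:M + -1 *: delta_mx j k) =
   1%:M - z *: delta_mx i j - delta_mx j k + z *: delta_mx i k :> 'M[C]_p.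
  rewrite mulmxDl !mulmxDr !mul1mx !mulmx1 scaleN1r !scaleNr mulNmx mulmxN opprK.
  by rewrite -scalemxAl mul_delta_mx -!addrA; congr (_ + _); rewrite addrCA.
rewrite {}e1 {}e2 !mulmxDl !mulmxDr !mul1mx !mulmx1.
rewrite !mulmxN -!scalemxAl -!scalemxAr !mul_delta_mx.
rewrite !mul_delta_mx_0 // 1?eq_sym //.
rewrite !scaler0; move: (1%:M : 'M[C]_p) (z *: delta_mx i j) (z *: delta_mx i k) (delta_mx j k).
by move=> I0 X Y Z; apply/matrixP => a b; rewrite !mxE; ring.
Qed.

Lemma Q_one : Q 1%:M.
Proof.
by apply: Qtorus; split=> [i j /negPf nij|]; [rewrite mxE nij|exact: unitmx1].
Qed.

(** Transvections into the same column [k] multiply by adding their off-diagonal parts, because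
    [delta_mx b k *m delta_mx a k = 0] when [a] differs from [k]. *)
Lemma Q_column (k : 'I_p) (s : seq 'I_p) (l : 'I_p -> C) :
  (forall a, l a != 0 -> blk a k) -> k \notin s ->
  Q (1%:M + \sum_(a <- s) l a *: delta_mx a k).
Proof.
move=> hl; elim: s => [|a s IH]; first by rewrite big_nil addr0 => _; apply: Q_one.
rewrite inE negb_or => /andP[nka /IH Qs].
have [la|/hl[ak|qa]] := eqVneq (l a) 0.
- by rewrite big_cons la scale0r add0r.
- by rewrite ak eqxx in nka.
have := QM Qs (qa (l a)); congr Q; rewrite /transv big_cons.
have z : (\sum_(b <- s) l b *: delta_mx b k) *m (l a *: delta_mx a k) = 0.
  rewrite mulmx_suml big1 // => b _.
  by rewrite -scalemxAl -scalemxAr mul_delta_mx_0 // !scaler0.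
by rewrite mulmxDl !mulmxDr !mul1mx !mulmx1 z addr0 -addrA.
Qed.

Lemma unitmx_ker0 (M : 'M[C]_p) (v : 'cV[C]_p) : M \in unitmx -> M *m v = 0 -> v = 0.
Proof. by move=> uM h; rewrite -[v](mulKmx uM) h mulmx0. Qed.

(** The columns before [k] are already multiples of basis vectors. If column [k] vanished from row
    [k] on, it would be a combination of them. *)
Lemma exists_pivot (M : 'M[C]_p) (k : 'I_p) : M \in unitmx ->
  (forall a b : 'I_p, (b < k)%N -> a != b -> M a b = 0) ->
  exists2 i : 'I_p, (k <= i)%N & M i k != 0.
Proof.
move=> uM hM; apply: contrapT => hn.
have hk (i : 'I_p) : (k <= i)%N -> M i k = 0.
  by move=> ki; apply/eqP/negP => /negP h; apply: hn; exists i.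
have hd (b : 'I_p) : (b < k)%N -> M b b != 0.
  move=> bk; apply/negP => /eqP Mbb.
  have : delta_mx b 0 = 0 :> 'cV[C]_p.
    apply: (unitmx_ker0 uM); rewrite -colE; apply/matrixP => a j; rewrite !mxE.
    by have [->|/hM ->] := eqVneq a b.
  by move/matrixP/(_ b 0)/eqP; rewrite !mxE !eqxx oner_eq0.
(* The coefficients of that linear dependence, hence a kernel vector with entry [1] at [k]. *)
pose v : 'cV[C]_p := \col_a ((a == k)%:R - (a < k)%:R * (M a k / M a a)).
have : v = 0.
  apply: (unitmx_ker0 uM); apply/matrixP => a j; rewrite !mxE.
  transitivity (M a k - (a < k)%:R * M a k); last first.
    by case: ltnP => [|/hk ->]; rewrite ?mul1r ?subrr ?mul0r ?subr0.
  under eq_bigr do rewrite mxE mulrBr.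
  rewrite sumrB; congr (_ - _).
    rewrite (bigD1 k) //= eqxx mulr1 big1 ?addr0 // => b /negPf ->.
    by rewrite mulr0.
  rewrite (bigD1 a) //= big1 ?addr0.
    by case: ltnP => h; rewrite ?mul0r ?mulr0 // !mul1r mulrC divfK ?hd.
  move=> b ba; case: ltnP => h; last by rewrite mul0r mulr0.
  by rewrite hM ?mul0r // eq_sym.
move/matrixP/(_ k 0)/eqP; rewrite !mxE eqxx ltnn mul0r subr0.
by rewrite oner_eq0.
Qed.

Lemma Q_cancel (L M : 'M[C]_p) L' : Q L' -> L' *m L = 1%:M -> Q (L *m M) -> Q M.
Proof. by move=> QL e QLM; rewrite -[M]mul1mx -e -mulmxA; apply: QM. Qed.

(** Gauss-Jordan elimination whose row operations all lie in [Q]: rows are combined only within a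
    class of [blk], so the support condition survives each operation, and what remains at the end is
    an element of the torus. *)
Lemma Q_of_mask (M : 'M[C]_p) : masked blk M -> M \in unitmx -> Q M.
Proof.
(* Invariant: the first [p - d] columns are already diagonal, so [d] counts the columns still to be
   cleared. *)
suff H d (N : 'M[C]_p) : masked blk N -> N \in unitmx ->
    (forall a b : 'I_p, (b < p - d)%N -> a != b -> N a b = 0) -> Q N.
  by move=> hM uM; apply: (H p) => // a b; rewrite subnn.
elim: d N => [|d IH] N hN uN hz.
  by apply: Qtorus; split=> // a b; apply: hz; rewrite subn0.
have [dp|pd] := ltnP d p; last first.
  by apply: IH => // a b; have /eqP -> : (p - d == 0)%N by rewrite subn_eq0.
have kp : (p - d.+1 < p)%N by lia.
pose k := Ordinal kp.
have kE : (p - d = k.+1)%N by rewrite /=; lia.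
(* A zero pivot is repaired by adding a lower row [i] to row [k]; a transvection takes the place of
   the usual row exchange. *)
wlog Nkk : N hN uN hz / N k k != 0.
  move=> W; have [i ki Nik] := exists_pivot (k := k) uN hz.
  have [Nkk|Nkk] := eqVneq (N k k) 0; last exact: W.
  have nki : k != i by apply: contraNneq Nik => <-; rewrite Nkk.
  have bki : blk k i by apply: blk_sym; apply: hN.
  have qki z : Q (transv k i z) by case: bki => // e; rewrite e eqxx in nki.
  have e1 : transv k i (-1) *m transv k i 1 = 1%:M.
    rewrite /transv mulmxDl !mulmxDr !mul1mx !mulmx1 -scalemxAl -scalemxAr mul_delta_mx_0 1?eq_sym //.
    by rewrite !scaler0 addr0 scale1r scaleN1r addrK.
  apply: (Q_cancel (qki (-1)) e1).
  have eM a b : (transv k i 1 *m N) a b = N a b + (a == k)%:R * N i b.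
    rewrite /transv mulmxDl mul1mx scale1r mxE; congr (_ + _).
    rewrite mxE (bigD1 i) //= mxE eqxx andbT big1 ?addr0 // => c /negPf nc.
    by rewrite mxE nc andbF mul0r.
  apply: W.
  - apply: (maskedM blk_trans _ hN).
    apply: maskedD; first exact: masked1 blk_refl.
    apply: maskedZ => a b; rewrite mxE.
    have [->|_] := eqVneq a k; last by rewrite eqxx.
    by have [->|_] := eqVneq b i; [|rewrite eqxx].
  - by rewrite unitmx_mul uN andbT; apply: Qu.
  - move=> a b bk ab; rewrite eM hz // add0r (hz i) ?mulr0 //.
    by apply: contraTneq bk => <-; rewrite -leqNgt.
  - by rewrite eM eqxx mul1r Nkk add0r.
(* Multipliers clearing column [k] both above and below the diagonal. Row [k] is zero in the earlier
   columns, so these stay diagonal. *)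
pose l a : C := if a == k then 0 else - (N a k / N k k).
have hl a : l a != 0 -> blk a k.
  rewrite /l; have [_|_ h] := eqVneq a k; first by rewrite eqxx.
  by apply: hN; apply: contraNneq h => ->; rewrite mul0r oppr0.
pose s := [seq a <- enum 'I_p | a != k].
have ks : k \notin s by rewrite mem_filter eqxx.
(* The parameter [e] handles the elimination matrix ([e = 1]) and its inverse ([e = -1])
   together. *)
have Qc (e : C) : Q (1%:M + \sum_(a <- s) (e * l a) *: delta_mx a k).
  apply: Q_column => // a h; apply: hl; apply: contraNneq h => ->.
  by rewrite mulr0.
set L := 1%:M + \sum_(a <- s) (1 * l a) *: delta_mx a k.
have LE (e : C) : \sum_(a <- s) (e * l a) *: delta_mx a k = \matrix_(a, b) ((b == k)%:R * (e * l a)) :> 'M[C]_p.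
  rewrite /s big_filter big_enum_cond /=; apply/matrixP => a b; rewrite summxE mxE.
  have [->|ak] := eqVneq a k.
    rewrite /l eqxx !mulr0 big1 // => c ck; rewrite !mxE.
    by rewrite [k == c]eq_sym (negPf ck) mulr0.
  rewrite (bigD1 a) //= big1 ?addr0; first by rewrite !mxE eqxx mulrC.
  by move=> c /andP[_ ca]; rewrite !mxE [a == c]eq_sym (negPf ca) mulr0.
have lk : l k = 0 by rewrite /l eqxx.
have eM (e : C) (A : 'M[C]_p) a b : ((1%:M + \sum_(a <- s) (e * l a) *: delta_mx a k) *m A) a b
    = A a b + e * l a * A k b.
  rewrite LE mulmxDl mul1mx mxE; congr (_ + _); rewrite mxE (bigD1 k) //=.
  rewrite mxE eqxx mul1r big1 ?addr0 // => c /negPf nc.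
  by rewrite mxE nc !mul0r.
apply: (Q_cancel (L := L) (Qc (-1))).
  by apply/matrixP => a b; rewrite eM /L LE !mxE lk [k == b]eq_sym; ring.
apply: IH.
- apply: (maskedM blk_trans _ hN).
  apply: maskedD; first exact: masked1 blk_refl.
  rewrite LE => a b; rewrite mxE; have [->|_] := eqVneq b k; last by rewrite mul0r eqxx.
  by rewrite !mul1r; apply: hl.
- by rewrite unitmx_mul uN andbT; apply: Qu; apply: Qc.
- rewrite kE => a b; rewrite ltnS leq_eqVlt => /orP[/eqP bk|bk] ab.
    have bk' : b = k by apply: val_inj.
    rewrite bk' in ab *.
    rewrite eM mul1r /l; have [ak|_] := eqVneq a k; last by rewrite mulNr divfK // subrr.
    by rewrite ak eqxx in ab.
  rewrite eM hz // (hz k) ?mulr0 ?addr0 //.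
  by apply: contraTneq bk => <-; rewrite ltnn.
Qed.

End Factor.
End Mask.

(** * Limits and exponential sums in Zariski closed sets *)

Section Closed.
Variable R : realType.
Local Notation C := R[i].

Definition ccvg (u : nat -> C) (l : C) : Prop :=
  (fun n => complex.Re (u n)) @ \oo --> complex.Re l /\
  (fun n => complex.Im (u n)) @ \oo --> complex.Im l.

Lemma ccvg_cst c : ccvg (fun=> c) c.
Proof. by split; apply: cvg_cst. Qed.

Lemma ccvg_rC (u : nat -> R) l : u @ \oo --> l -> ccvg (fun n => rC (u n)) (rC l).
Proof. by move=> h; split => //=; apply: cvg_cst. Qed.

Lemma cReD (z w : C) : complex.Re (z + w) = complex.Re z + complex.Re w.
Proof. by case: z w => [? ?] []. Qed.

Lemma cImD (z w : C) : complex.Im (z + w) = complex.Im z + complex.Im w.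
Proof. by case: z w => [? ?] []. Qed.

Lemma ccvgD u v l k : ccvg u l -> ccvg v k -> ccvg (fun n => u n + v n) (l + k).
Proof.
move=> [u1 u2] [v1 v2]; split.
  by rewrite cReD (_ : (fun n => _) = fun n => complex.Re (u n) + complex.Re (v n));
    [apply: cvgD|apply/funext => n; rewrite cReD].
by rewrite cImD (_ : (fun n => _) = fun n => complex.Im (u n) + complex.Im (v n));
    [apply: cvgD|apply/funext => n; rewrite cImD].
Qed.

Lemma ccvgM u v l k : ccvg u l -> ccvg v k -> ccvg (fun n => u n * v n) (l * k).
Proof.
move=> [u1 u2] [v1 v2]; split.
  rewrite cReM (_ : (fun n => _) = fun n => complex.Re (u n) * complex.Re (v n) -
     complex.Im (u n) * complex.Im (v n)); last by apply/funext => n; rewrite cReM.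
  by apply: cvgB; apply: cvgM.
rewrite cImM (_ : (fun n => _) = fun n => complex.Re (u n) * complex.Im (v n) +
     complex.Im (u n) * complex.Re (v n)); last by apply/funext => n; rewrite cImM.
by apply: cvgD; apply: cvgM.
Qed.

Lemma ccvg_unique u l k : ccvg u l -> ccvg u k -> l = k.
Proof.
move=> [u1 u2] [v1 v2]; apply: complex_eqP.
  exact: (cvg_unique _ u1 v1).
exact: (cvg_unique _ u2 v2).
Qed.

Section FunctionAlgebra.
Variables (T : Type) (F : (T -> C) -> Prop).
Hypotheses (Fc : forall c, F (fun=> c))
  (FD : forall f g, F f -> F g -> F (fun t => f t + g t))
  (FM : forall f g, F f -> F g -> F (fun t => f t * g t)).

Lemma closed_sum (I : Type) (s : seq I) (f : I -> T -> C) :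
  (forall i, F (f i)) -> F (fun t => \sum_(i <- s) f i t).
Proof.
move=> Ff; elim: s => [|i s IH].
  by rewrite (_ : (fun t => _) = fun=> 0) //; apply/funext => t; rewrite big_nil.
rewrite (_ : (fun t => _) = fun t => f i t + \sum_(j <- s) f j t); first exact: FD.
by apply/funext => t; rewrite big_cons.
Qed.

Lemma closed_prod (I : Type) (s : seq I) (f : I -> T -> C) :
  (forall i, F (f i)) -> F (fun t => \prod_(i <- s) f i t).
Proof.
move=> Ff; elim: s => [|i s IH].
  by rewrite (_ : (fun t => _) = fun=> 1) //; apply/funext => t; rewrite big_nil.
rewrite (_ : (fun t => _) = fun t => f i t * \prod_(j <- s) f j t); first exact: FM.
by apply/funext => t; rewrite big_cons.
Qed.

Lemma closed_pow (f : T -> C) k : F f -> F (fun t => f t ^+ k).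
Proof.
move=> Ff; elim: k => [|k IH].
  by rewrite (_ : (fun t => _) = fun=> 1).
rewrite (_ : (fun t => _) = fun t => f t * f t ^+ k); first exact: FM.
by apply/funext => t; rewrite exprS.
Qed.

(** Stated for an abstract algebra [F] of functions because it is used for two: convergent sequences
    paired with their limit, as functions on [option nat] with the limit at [None], and exponential
    sums in a real parameter. *)
Lemma closed_meval k (P : mpoly.mpoly k C) (v : T -> 'I_k -> C) :
  (forall i, F (v^~ i)) -> F (fun t => mpoly.meval (v t) P).
Proof.
move=> Fv; rewrite (funext (fun t => mpoly.mevalE (v t) P)).
apply: closed_sum => d; apply: FM => //.
by apply: closed_prod => i; apply: closed_pow.
Qed.

End FunctionAlgebra.

Section Pairs.
Variables m n : nat.

Lemma coordsP (k : 'I_(m * m + n * n)) :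
  (exists i j, forall g : 'M[C]_m * 'M[C]_n, coords g k = g.1 i j) \/
  (exists i j, forall g : 'M[C]_m * 'M[C]_n, coords g k = g.2 i j).
Proof.
case: (split_ordP k) => l ->; [left|right]; case/mxvec_indexP: l => i j;
  exists i, j => g; by rewrite /coords ?row_mxEl ?row_mxEr mxvecE.
Qed.

(** The limit is required to be invertible, since the closedness in question is relative to the
    general linear groups. *)
Definition seq_closed (G : set ('M[C]_m * 'M[C]_n)) : Prop :=
  forall (u : nat -> 'M[C]_m * 'M[C]_n) (l : 'M[C]_m * 'M[C]_n), (forall k, G (u k)) ->
  (forall i j, ccvg (fun k => (u k).1 i j) (l.1 i j)) ->
  (forall i j, ccvg (fun k => (u k).2 i j) (l.2 i j)) -> GLpair l -> G l.

Lemma zariski_seq_closed G : zariski_closed G -> seq_closed G.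
Proof.
case=> S -> u l Gu c1 c2 gl; split=> // P SP.
pose v (o : option nat) := coords (if o is Some k then u k else l).
have h : ccvg (fun k => mpoly.meval (v (Some k)) P) (mpoly.meval (v None) P).
  apply: (@closed_meval _ (fun f => ccvg (fun k => f (Some k)) (f None))).
  - by move=> c; apply: ccvg_cst.
  - by move=> f g; apply: ccvgD.
  - by move=> f g; apply: ccvgM.
  move=> i; have [[a [b e]]|[a [b e]]] := coordsP i; rewrite /v e.
    by rewrite (_ : (fun k => _) = fun k => (u k).1 a b) //; apply/funext => k; rewrite e.
  by rewrite (_ : (fun k => _) = fun k => (u k).2 a b) //; apply/funext => k; rewrite e.
apply: ccvg_unique h _; rewrite (_ : (fun k => _) = fun=> 0); first exact: ccvg_cst.
by apply/funext => k; have [_ ->] := Gu k.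
Qed.

End Pairs.

Definition expsum (f : R -> C) : Prop := exists s : seq (C * R),
  forall t, f t = \sum_(e <- s) e.1 * rC (expR (t * e.2)).

Lemma expsum_cst c : expsum (fun=> c).
Proof. by exists [:: (c, 0)] => t; rewrite big_seq1 mulr0 expR0 rmorph1 mulr1. Qed.

Lemma expsumD f g : expsum f -> expsum g -> expsum (fun t => f t + g t).
Proof. by move=> [s hs] [r hr]; exists (s ++ r) => t; rewrite big_cat hs hr. Qed.

Lemma expsumM f g : expsum f -> expsum g -> expsum (fun t => f t * g t).
Proof.
move=> [s hs] [r hr]; exists [seq (a.1 * b.1, a.2 + b.2) | a <- s, b <- r] => t.
rewrite big_allpairs_dep hs hr mulr_suml; apply: eq_bigr => a _.
rewrite mulr_sumr; apply: eq_bigr => b _ /=.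
by rewrite mulrDr expRD rmorphM; ring.
Qed.

Lemma expsum_spec p (U : 'M[C]_p) x a b :
  expsum (fun t => spec U (fun i => expR (t * x i)) a b).
Proof.
exists [seq (conjc (U l a) * U l b, x l) | l <- index_enum 'I_p] => t.
by rewrite specE big_map.
Qed.

(* Interpolate [m |-> m ^ t] by a polynomial at the finitely many bases: the value at [t]
   is a linear combination of the values at natural numbers. *)
Lemma expsum_eq0 f : expsum f -> (forall k : nat, f k%:R = 0) -> forall t, f t = 0.
Proof.
move=> [s hs] h0 t.
have [q hq] := poly_interpolation [seq expR e.2 | e <- s] (fun y => expR (t * ln y)).
rewrite hs; transitivity (\sum_(k < size q) rC q`_k * f k%:R); last first.
  by rewrite big1 // => k _; rewrite h0 mulr0.
under [RHS]eq_bigr do rewrite hs mulr_sumr.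
rewrite exchange_big /= big_seq [RHS]big_seq; apply: eq_bigr => e es.
have <- : q.[expR e.2] = expR (t * e.2).
  by rewrite hq ?expRK //; apply: (map_f (fun e : C * R => expR e.2) es).
rewrite horner_coef rmorph_sum mulr_sumr; apply: eq_bigr => k _ /=.
by rewrite expRM_natl !rmorphM; ring.
Qed.

End Closed.

(** * Isolating a root by degenerating along the torus *)

Section Structure.
Variable R : realType.
Local Notation C := R[i].

Definition dilation p (i j : 'I_p) (s : R) (a : 'I_p) : R :=
  if a == i then s^-1 else if a == j then s else 1.

Lemma cvg_harmonicX e : (fun n => @harmonic R n ^+ e.+1) @ \oo --> (0 : R).
Proof.
elim: e => [|e IH]; first exact: cvg_harmonic.
rewrite -[X in _ --> X](mul0r (0 : R)).
rewrite (_ : (fun n => _) = fun n => @harmonic R n * harmonic n ^+ e.+1).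
  by apply: cvgM => //; apply: cvg_harmonic.
by apply/funext => n; rewrite exprS.
Qed.

(** Conjugation scales entry [(a, b)] by a power of [u] with exponent at least [-2], and the value
    [-2] occurs only at [(i, j)]. After multiplication by [u^2] every other off-diagonal entry
    carries a positive power. *)
Lemma cvg_dilation p (i j a b : 'I_p) (u : nat -> R) : (forall n, u n != 0) ->
  (forall e, (fun n => u n ^+ e.+1) @ \oo --> (0 : R)) -> i != j -> a != b ->
  (fun n => dilation i j (u n) a / dilation i j (u n) b * u n ^+ 2)
    @ \oo --> (((a == i) && (b == j))%:R : R).
Proof.
move=> s0 hu ij ab.
rewrite /dilation.
have [ai|nai] := eqVneq a i; have [bj|nbj] := eqVneq b j => /=.
- have -> : b == i = false by rewrite bj eq_sym (negPf ij).
  rewrite (_ : (fun n => _) = fun=> 1); first exact: cvg_cst.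
  by apply/funext => n; move: (s0 n) => h; field.
- rewrite -ai [b == a]eq_sym (negPf ab).
  rewrite (_ : (fun n => _) = fun n => u n ^+ 1); first exact: hu.
  by apply/funext => n; move: (s0 n) => h; field.
- have -> : b == i = false by rewrite bj eq_sym (negPf ij).
  rewrite -bj (negPf ab).
  rewrite (_ : (fun n => _) = fun n => u n ^+ 1); first exact: hu.
  by apply/funext => n; move: (s0 n) => h; field.
have [aj|naj] := eqVneq a j; have [bi|nbi] := eqVneq b i.
- rewrite (_ : (fun n => _) = fun n => u n ^+ 4); first exact: hu.
  by apply/funext => n; move: (s0 n) => h; field.
- rewrite (_ : (fun n => _) = fun n => u n ^+ 3); first exact: hu.
  by apply/funext => n; move: (s0 n) => h; field.
- rewrite (_ : (fun n => _) = fun n => u n ^+ 3); first exact: hu.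
  by apply/funext => n; move: (s0 n) => h; field.
rewrite (_ : (fun n => _) = fun n => u n ^+ 2); first exact: hu.
by apply/funext => n; move: (s0 n) => h; field.
Qed.

Lemma cvg_expR_harmonic (h : R) :
  (fun n => expR (harmonic n ^+ 2 * h)) @ \oo --> (1 : R).
Proof.
rewrite -(expR0 R); apply: continuous_cvg; first exact: continuous_expR.
rewrite -[X in _ --> X](mul0r h).
by apply: cvgM; [exact: cvg_harmonicX|exact: cvg_cst].
Qed.

(** Both bounds of the squeeze, [h] and [h * exp(t h)], come from [1 + x <= exp x], used at [t h]
    and at [- t h]. *)
Lemma cvg_expR_quotient (h : R) :
  (fun n => (expR (harmonic n ^+ 2 * h) - 1) / harmonic n ^+ 2) @ \oo --> h.
Proof.
apply: (@squeeze_cvgr _ _ _ _ (fun=> h) (fun n => h * expR (harmonic n ^+ 2 * h))).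
- apply: nearW => n; set t := harmonic n ^+ 2.
  have t0 : 0 < t by rewrite exprn_gt0 // /harmonic invr_gt0.
  rewrite ler_pdivlMr // ler_pdivrMr //; apply/andP; split.
    by have := expR_ge1Dx (t * h); lra.
  have := expR_ge1Dx (- (t * h)); rewrite expRN => h1.
  have := expR_gt0 (t * h) => e0.
  have : (1 - t * h) * expR (t * h) <= 1.
    by rewrite -ler_pdivlMr // div1r.
  by nra.
- exact: cvg_cst.
rewrite -[X in _ --> X]mulr1.
by apply: cvgM; [exact: cvg_cst|exact: cvg_expR_harmonic].
Qed.

Definition cdiag p (d : 'I_p -> C) : 'M[C]_p := diag_mx (\row_i d i).

Lemma cdiagM p (d e : 'I_p -> C) (M : 'M[C]_p) a b :
  (cdiag d *m M *m cdiag e) a b = d a * M a b * e b.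
Proof. by rewrite /cdiag mul_mx_diag mul_diag_mx !mxE. Qed.

Lemma torus_cdiag p (d : 'I_p -> C) : (forall a, d a != 0) -> torus (cdiag d).
Proof.
move=> hd; split=> [i j nij|]; first by rewrite !mxE (negPf nij).
have e : cdiag d *m cdiag (fun a => (d a)^-1) = 1%:M.
  apply/matrixP => a b; rewrite -[cdiag d]mulmx1 cdiagM !mxE.
  have [<-|_] := eqVneq a b; first by rewrite mulr1 mulfV.
  by rewrite mulr0 mul0r.
by have [] := mulmx1_unit e.
Qed.

Lemma transvE p (i j : 'I_p) (z : C) a b :
  transv i j z a b = (a == b)%:R + z * ((a == i) && (b == j))%:R.
Proof. by rewrite !mxE. Qed.

Lemma ccvg_spec p (U : 'M[C]_p) (u : nat -> 'I_p -> R) (v : 'I_p -> R) a b :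
  (forall l, (fun k => u k l) @ \oo --> v l) ->
  ccvg (fun k => spec U (u k) a b) (spec U v a b).
Proof.
move=> huv; rewrite specE.
rewrite (_ : (fun k => _) = fun k => \sum_l conjc (U l a) * U l b * rC (u k l)); last first.
  by apply/funext => k; rewrite specE.
apply: (@closed_sum _ (option nat) (fun f => ccvg (fun k => f (Some k)) (f None)) _ _ _ _
  (fun l o => conjc (U l a) * U l b * rC (if o is Some k then u k l else v l))).
- by move=> c; apply: ccvg_cst.
- by move=> f g; apply: ccvgD.
by move=> l; apply: ccvgM; [exact: ccvg_cst|exact: ccvg_rC].
Qed.

(* Conjugate [exp (s^2 H)] by the torus element [diag (1/s at i, s at j)]: as [s] tends to [0]
   only the first-order contribution of the entry [(i, j)] survives. *)
Lemma blk_of_curve m n (G : set ('M[C]_m * 'M[C]_n)) (U : 'M[C]_m) (x : 'I_m -> R)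
    (V : 'M[C]_n) (y : 'I_n -> R) i j :
  seq_closed G -> (forall g h, G g -> G h -> G (g.1 *m h.1, g.2 *m h.2)) ->
  (forall D, torus D -> G (D, 1%:M)) -> unitary U -> unitary V ->
  (forall t, G (spec U (fun a => expR (t * x a)), spec V (fun a => expR (t * y a)))) ->
  spec U x i j != 0 -> @blk _ _ (fun X => G (X, 1%:M)) i j.
Proof.
move=> clG GM Gt hU hV Gxy Hij.
have [->|nij] := eqVneq i j; first by left.
right => z.
have G1 : G (1%:M, 1%:M).
  by apply: Gt; split=> [a b /negPf nab|]; [rewrite mxE nab|exact: unitmx1].
have conj (d : 'I_m -> C) g : (forall a, d a != 0) -> G g ->
    G (cdiag d *m g.1 *m cdiag (fun a => (d a)^-1), g.2).
  move=> hd Gg.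
  have h1 := Gt _ (torus_cdiag hd).
  have h2 : G (cdiag (fun a => (d a)^-1), 1%:M).
    by apply: Gt; apply: torus_cdiag => a; rewrite invr_eq0.
  by have := GM _ _ (GM _ _ h1 Gg) h2; rewrite /= mul1mx mulmx1.
have tu w : (transv i j w : 'M[C]_m) \in unitmx.
  have e : transv i j w *m transv i j (- w) = 1%:M :> 'M[C]_m.
    rewrite /transv mulmxDl !mulmxDr !mul1mx !mulmx1 -scalemxAl -scalemxAr mul_delta_mx_0 1?eq_sym //.
    by rewrite !scaler0 addr0 scaleNr addrNK.
  by have [] := mulmx1_unit e.
pose s := @harmonic R.
have s0 k : s k != 0 by rewrite /s /harmonic invr_neq0.
pose d k a : C := rC (dilation i j (s k) a).
have d0 k a : d k a != 0.
  rewrite /d (fmorph_eq0 (@rC R)) /dilation.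
  by case: ifP => _; [rewrite invr_eq0|case: ifP => _; [|exact: oner_neq0]].
have Glim : G (transv i j (spec U x i j), 1%:M).
  apply: (clG (fun k => (cdiag (d k) *m spec U (fun a => expR (s k ^+ 2 * x a))
    *m cdiag (fun a => (d k a)^-1), spec V (fun a => expR (s k ^+ 2 * y a))))).
  - by move=> k; apply: (conj (d k) (spec U _, spec V _)).
  - move=> a b /=.
    (* Each entry is the identity plus a dilation factor times the difference quotient of the
       exponential at time [s^2]; the quotient converges to [spec U x a b] and the factor selects
       [(i, j)]. *)
    rewrite (_ : (fun k => _) = fun k => (a == b)%:R +
        rC (dilation i j (s k) a / dilation i j (s k) b * s k ^+ 2) *
        \sum_l conjc (U l a) * U l b * rC ((expR (s k ^+ 2 * x l) - 1) / s k ^+ 2)).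
      rewrite transvE; apply: ccvgD; first exact: ccvg_cst.
      have lsum : ccvg (fun k => \sum_l conjc (U l a) * U l b *
          rC ((expR (s k ^+ 2 * x l) - 1) / s k ^+ 2)) (spec U x a b).
        rewrite (_ : (fun k => _) = fun k =>
          spec U (fun l => (expR (s k ^+ 2 * x l) - 1) / s k ^+ 2) a b).
          by apply: ccvg_spec => l; apply: cvg_expR_quotient.
        by apply/funext => k; rewrite specE.
      have [ab|ab] := eqVneq a b.
        have -> : (a == i) && (b == j) = false.
          by apply/negbTE/negP => /andP[/eqP ai /eqP bj]; move: nij; rewrite -ai -bj ab eqxx.
        have -> : spec U x i j * false%:R = 0 * spec U x a b by rewrite mulr0 mul0r.
        apply: ccvgM; last exact: lsum.
        rewrite -(rmorph0 (@rC R)); apply: ccvg_rC.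
        rewrite (_ : (fun k => _) = fun k => s k ^+ 2); first exact: cvg_harmonicX.
        apply/funext => k; rewrite ab divff ?mul1r //.
        by have := d0 k b; rewrite /d (fmorph_eq0 (@rC R)).
      have -> : spec U x i j * ((a == i) && (b == j))%:R =
          rC ((a == i) && (b == j))%:R * spec U x a b.
        rewrite rmorph_nat; case: eqP => [->|_]; last by rewrite mulr0 mul0r.
        by case: eqP => [->|_]; rewrite ?mulr0 ?mul0r // mulr1 mul1r.
      by apply: ccvgM => //; apply: ccvg_rC; apply: cvg_dilation => // e; apply: cvg_harmonicX.
    apply/funext => k; rewrite cdiagM specE /d -fmorphV.
    set da := dilation _ _ _ a; set db := dilation _ _ _ b.
    have U1 : \sum_l conjc (U l a) * U l b = (a == b)%:R.
      have := congr1 (fun M : 'M[C]_m => M a b) hU; rewrite !mxE => <-.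
      by apply: eq_bigr => l _; rewrite adj_mxE.
    have sk : s k ^+ 2 != 0 by rewrite expf_neq0.
    have -> : \sum_l conjc (U l a) * U l b * rC ((expR (s k ^+ 2 * x l) - 1) / s k ^+ 2) =
       rC (s k ^+ 2)^-1 * (\sum_l conjc (U l a) * U l b * rC (expR (s k ^+ 2 * x l)) - (a == b)%:R).
      rewrite -U1 -sumrB mulr_sumr; apply: eq_bigr => l _.
      by rewrite rmorphM rmorphB rmorph1; ring.
    set S := \sum_l _.
    have cancel : rC (da / db * s k ^+ 2) * rC (s k ^+ 2)^-1 = rC da * rC db^-1.
      by rewrite -rmorphM mulfK // rmorphM.
    rewrite mulrA cancel.
    have [ab|ab] := eqVneq a b; last by rewrite subr0 add0r mulrAC.
    have dd : rC da * rC db^-1 = 1.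
      rewrite -rmorphM /da /db ab divff ?rmorph1 //.
      by have := d0 k b; rewrite /d (fmorph_eq0 (@rC R)).
    by rewrite dd mulrAC dd !mul1r addrC subrK.
  - move=> a b /=.
    by rewrite -(spec1 hV); apply: ccvg_spec => l; apply: cvg_expR_harmonic.
  - by split; [exact: tu|exact: unitmx1].
have [->|z0] := eqVneq z 0; first by rewrite /transv scale0r addr0.
(* The limit gives one nonzero off-diagonal value. Conjugating by a diagonal matrix nontrivial only
   at [i] rescales it to any nonzero [z]. *)
pose e a : C := if a == i then z / spec U x i j else 1.
have e0 a : e a != 0.
  rewrite /e; case: ifP => _; last exact: oner_neq0.
  by rewrite mulf_neq0 ?invr_eq0.
have := conj e _ e0 Glim; congr (G (_, _)) => /=.
apply/matrixP => a b; rewrite cdiagM !transvE /e.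
have [->|ai] := eqVneq a i; have [->|bi] := eqVneq b i => /=.
- by rewrite (negPf nij) !mulr0 !addr0 mulr1 mulfV // mulf_neq0 ?invr_eq0.
- rewrite !add0r invr1 mulr1 mulrA.
  by case: eqP => _; rewrite ?mulr0 // !mulr1 divfK.
- by rewrite (negPf ai) !mulr0 !addr0 mulr0 mul0r.
by rewrite !mulr0 !addr0 invr1 mul1r mulr1.
Qed.
End Structure.

(** * The Lie algebra and the polar decomposition *)

Section Blocks.
Variable R : realType.
Local Notation C := R[i].

(** Reflexivity is asked of [r1] only: in case (ii) the relation [r2] is empty, which says that the
    second component vanishes. *)
Definition block_structure m n (G : set ('M[C]_m * 'M[C]_n))
    (r1 : 'I_m -> 'I_m -> Prop) (r2 : 'I_n -> 'I_n -> Prop) : Prop :=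
  [/\ forall i, r1 i i,
      (forall i j, r1 i j -> r1 j i) /\ (forall i j k, r1 i j -> r1 j k -> r1 i k),
      (forall i j, r2 i j -> r2 j i) /\ (forall i j k, r2 i j -> r2 j k -> r2 i k) &
      forall H, iLieK G H <-> [/\ Defs.hermitian H.1, Defs.hermitian H.2,
                                  masked r1 H.1 & masked r2 H.2]].

Lemma torus1 p : torus (1%:M : 'M[C]_p).
Proof. by split=> [i j /negPf nij|]; [rewrite mxE nij|exact: unitmx1]. Qed.

Lemma expmx0 p : expmx (0 : 'M[C]_p) = 1%:M.
Proof.
have u1 : unitary (1%:M : 'M[C]_p) by rewrite /unitary adj_mx1 mulmx1.
have -> : (0 : 'M[C]_p) = rC 0 *: spec 1%:M (fun=> 1) by rewrite rmorph0 scale0r.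
rewrite expmx_specZ // -[RHS](spec1 u1); apply: eq_spec => i.
by rewrite mul0r expR0.
Qed.

Lemma iLieK_curve m n (G : set ('M[C]_m * 'M[C]_n)) H : iLieK G H ->
  exists U x V y, [/\ unitary U, unitary V, H = (spec U x, spec V y) &
   forall t, G (spec U (fun a => expR (t * x a)), spec V (fun a => expR (t * y a)))].
Proof.
case: H => H1 H2 [LH [/= /hermitian_spec[U [x [hU eU]]] /hermitian_spec[V [y [hV eV]]]]].
rewrite eU eV in LH *; exists U, x, V, y; split=> // t.
by have := LH t; rewrite /= !expmx_specZ.
Qed.

Lemma spec_eq0 p (U : 'M[C]_p) x : unitary U -> spec U x = 0 -> forall i, x i = 0.
Proof.
move=> /[dup] hU /unitaryV hU' e i.
have : U *m spec U x *m adj_mx U = 0 by rewrite e mulmx0 mul0mx.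
rewrite /spec !mulmxA hU' mul1mx -mulmxA hU' mulmx1 => /matrixP/(_ i i)/eqP.
by rewrite !mxE eqxx (fmorph_eq0 (@rC R)) => /eqP.
Qed.

(** A nonzero entry of [H] produces a root of [G], which bounds the support. Conversely, if [H] is
    supported on the roots then so is [exp(t H)] by functional calculus, and being invertible it
    factors inside [G]. *)
Lemma symmetric_blocks m n (G : set ('M[C]_m * 'M[C]_n)) :
  symmetric_subgroup G ->
  (forall D E, torus D -> torus E -> G (D, E)) \/
  ((forall D, torus D -> G (D, 1%:M)) /\ (forall g, G g -> g.2 = 1%:M)) ->
  exists r1 r2, block_structure G r1 r2.
Proof.
move=> [[GL G1 GM GV] /zariski_seq_closed Gcl Gadj] cases.
pose Q1 X := G (X, 1%:M).
have Q1t D : torus D -> Q1 D.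
  by move=> tD; case: cases => [h|[h _]]; apply: h => //; apply: torus1.
have Q1u X : Q1 X -> X \in unitmx by case/GL.
have Q1M X Y : Q1 X -> Q1 Y -> Q1 (X *m Y).
  by move=> h1 h2; have := GM _ _ h1 h2; rewrite /= mulmx1.
have Q1a X : Q1 X -> Q1 (adj_mx X) by move/Gadj; rewrite /= adj_mx1.
have blk1 H : iLieK G H -> masked (blk Q1) H.1.
  move=> /iLieK_curve[U [x [V [y [hU hV -> Gt]]]]] i j hij.
  exact: (blk_of_curve Gcl GM Q1t hU hV Gt hij).
have str1 := conj (blk_sym Q1a) (blk_trans Q1M).
have exp1 U x : unitary U -> masked (blk Q1) (spec U x) -> forall t : R,
    G (spec U (fun a => expR (t * x a)), 1%:M).
  move=> hU hx t; apply: (Q_of_mask Q1u Q1M Q1a Q1t).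
    exact: (masked_spec (f := fun u => expR (t * u)) str1.2 (@blk_refl _ _ Q1) hU hx).
  by apply: (spec_unit hU _).1 => i; rewrite lt0r_neq0 ?expR_gt0.
case: cases => [Gt|[_ G2]]; last first.
  exists (blk Q1), (fun _ _ => False); split=> //; first exact: blk_refl.
  case=> H1 H2; split=> [HL|[/= h1 h2 m1 m2]].
    have [_ [h1 h2]] := HL; split=> //; first exact: (blk1 _ HL).
    have [U [x [V [y [hU hV [_ ->] Gt]]]]] := iLieK_curve HL.
    suff y0 i : y i = 0.
      by rewrite (eq_spec _ y0) => i j; rewrite specE big1 ?eqxx // => l _; rewrite rmorph0 mulr0.
    have := G2 _ (Gt 1); rewrite /= -(spec1 hV) => e.
    have : spec V (fun a => expR (1 * y a) - 1) = 0.
      rewrite (@eq_spec _ _ _ _ (fun a => expR (1 * y a) + -1 * 1)); last by move=> a; rewrite mulr1.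
      by rewrite -specD e -specZ rmorphN rmorph1 scaleN1r subrr.
    move/(spec_eq0 hV)/(_ i)/eqP; rewrite subr_eq0 mul1r -(expR0 R) => /eqP.
    exact: expR_inj.
  have [U [x [hU e1]]] := hermitian_spec h1.
  have e2 : H2 = 0 by apply/matrixP => i j; rewrite mxE; apply: (maskedP0 m2).
  split=> //= t; rewrite /= e2 scaler0 expmx0 e1 expmx_specZ //.
  by apply: exp1; rewrite // -e1.
(* Exchanging the two factors reduces the second component to the argument already made for the
   first. *)
pose Gf : set ('M[C]_n * 'M[C]_m) := [set g | G (g.2, g.1)].
have Gfcl : seq_closed Gf.
  move=> u l Gu c1 c2 [l1 l2].
  exact: (Gcl (fun k => ((u k).2, (u k).1)) (l.2, l.1)).
have GfM g h : Gf g -> Gf h -> Gf (g.1 *m h.1, g.2 *m h.2).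
  by move=> h1 h2; apply: (GM _ _ h1 h2).
pose Q2 Y := Gf (Y, 1%:M).
have Q2t D : torus D -> Q2 D by move=> tD; apply: Gt => //; apply: torus1.
have Q2u X : Q2 X -> X \in unitmx by case/GL.
have Q2M X Y : Q2 X -> Q2 Y -> Q2 (X *m Y).
  by move=> h1 h2; have := GM _ _ h1 h2; rewrite /= mulmx1.
have Q2a X : Q2 X -> Q2 (adj_mx X) by move/Gadj; rewrite /= adj_mx1.
have str2 := conj (blk_sym Q2a) (blk_trans Q2M).
exists (blk Q1), (blk Q2); split; [exact: blk_refl|exact: str1|exact: str2|].
case=> H1 H2; split=> [HL|[/= h1 h2 m1 m2]].
  have [_ [h1 h2]] := HL; split=> //; first exact: (blk1 _ HL).
  have [U [x [V [y [hU hV [_ ->] Gxy]]]]] := iLieK_curve HL.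
  by move=> i j hij; apply: (blk_of_curve Gfcl GfM Q2t hV hU _ hij) => t; apply: Gxy.
have [U [x [hU e1]]] := hermitian_spec h1.
have [V [y [hV e2]]] := hermitian_spec h2.
split=> //= t; rewrite /= e1 e2 !expmx_specZ //.
have g1 := exp1 U x hU; rewrite -e1 in g1.
suff g2 : G (1%:M, spec V (fun a => expR (t * y a))).
  by have := GM _ _ (g1 m1 t) g2; rewrite /= mul1mx mulmx1.
apply: (Q_of_mask Q2u Q2M Q2a Q2t).
  rewrite e2 in m2.
  exact: (masked_spec (f := fun u => expR (t * u)) str2.2 (@blk_refl _ _ Q2) hV m2).
by apply: (spec_unit hV _).1 => i; rewrite lt0r_neq0 ?expR_gt0.
Qed.

Definition sqn (z : C) : R := complex.Re z ^+ 2 + complex.Im z ^+ 2.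

Lemma conj_mul_sqn (z : C) : conjc z * z = rC (sqn z).
Proof. by case: z => a b; apply: complex_eqP; rewrite /sqn /=; ring. Qed.

Lemma sqn_ge0 z : 0 <= sqn z.
Proof. by rewrite addr_ge0 ?sqr_ge0. Qed.

Lemma sqn_eq0 z : sqn z = 0 -> z = 0.
Proof.
case: z => a b /eqP; rewrite /sqn paddr_eq0 ?sqr_ge0 //= !sqrf_eq0.
by move=> /andP[/eqP -> /eqP ->].
Qed.

(** The eigenvalues are the squared column norms of the invertible matrix [w *m adj_mx U], hence
    positive, and their logarithms exist. *)
Lemma gram_spec p (w : 'M[C]_p) : w \in unitmx ->
  exists U x, unitary U /\ adj_mx w *m w = spec U (fun i => expR (x i)).
Proof.
move=> uw; have hP : Defs.hermitian (adj_mx w *m w) by rewrite /Defs.hermitian adj_mxM adj_mxK.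
have [U [mu [hU e]]] := hermitian_spec hP.
have hU' := unitaryV hU.
have [uU _] := mulmx1_unit hU'.
pose B := w *m adj_mx U.
have uB : B \in unitmx by rewrite unitmx_mul uw; have [_ ->] := mulmx1_unit hU'.
have muE l : mu l = \sum_a sqn (B a l).
  have : (adj_mx B *m B) l l = rC (mu l).
    rewrite /B adj_mxM adj_mxK -!mulmxA [adj_mx w *m _]mulmxA e /spec !mulmxA.
    by rewrite hU' mul1mx -mulmxA hU' mulmx1 !mxE eqxx.
  rewrite mxE (eq_bigr (fun a => rC (sqn (B a l)))); last first.
    by move=> a _; rewrite adj_mxE conj_mul_sqn.
  by rewrite -rmorph_sum => /(fmorph_inj (@rC R)).
have mu0 l : 0 < mu l.
  rewrite lt_neqAle muE sumr_ge0 ?andbT; last by move=> *; apply: sqn_ge0.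
  apply/negP => /eqP s0.
  have : delta_mx l 0 = 0 :> 'cV[C]_p.
    apply: (unitmx_ker0 uB); rewrite -colE; apply/matrixP => a j; rewrite mxE [RHS]mxE.
    apply: sqn_eq0; move/esym/psumr_eq0P: s0 => -> // b _; exact: sqn_ge0.
  by move/matrixP/(_ l 0)/eqP; rewrite !mxE !eqxx oner_eq0.
exists U, (fun i => ln (mu i)); split=> //.
by rewrite e; apply: eq_spec => i; rewrite lnK // posrE.
Qed.

(** The pair of matrices [adj_mx w *m w] lies in [G] with all its natural powers. A defining
    polynomial of [G] restricted to its real powers is an exponential sum vanishing at the natural
    numbers, hence identically zero, so the logarithm is in [iLie(K)], and so is half of it. The
    factors [k1] and [k2] are claimed to be unitary only, which suffices because the cost is
    unitarily invariant. *)
Lemma polar m n (G : set ('M[C]_m * 'M[C]_n)) r1 r2 w :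
  symmetric_subgroup G -> block_structure G r1 r2 -> G w ->
  exists k1 k2 H, [/\ unitary k1, unitary k2, iLieK G H,
    w.1 = k1 *m expmx H.1 & w.2 = k2 *m expmx H.2].
Proof.
move=> [[GL G1 GM GV] [S eG] Gadj] [_ _ _ str] Gw.
have [uw1 uw2] := GL _ Gw.
have [U [x [hU eU]]] := gram_spec uw1; have [V [y [hV eV]]] := gram_spec uw2.
have GP : G (spec U (fun i => expR (x i)), spec V (fun i => expR (y i))).
  by rewrite -eU -eV; apply: (GM _ _ (Gadj _ Gw) Gw).
have Gk (k : nat) : G (spec U (fun i => expR (k%:R * x i)), spec V (fun i => expR (k%:R * y i))).
  elim: k => [|k IH].
    rewrite (@eq_spec _ _ _ _ (fun=> 1)) ?spec1 //; last by move=> i; rewrite mul0r expR0.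
    by rewrite (@eq_spec _ _ _ _ (fun=> 1)) ?spec1 // => i; rewrite mul0r expR0.
  have step p (z : 'I_p -> R) i : expR (z i) * expR (k%:R * z i) = expR (k.+1%:R * z i).
    by rewrite -expRD -natr1 mulrDl mul1r addrC.
  have := GM _ _ GP IH; rewrite /= (spec_mul _ _ hU) (spec_mul _ _ hV).
  by rewrite (eq_spec U (@step m x)) (eq_spec V (@step n y)).
have Gt (t : R) : G (spec U (fun i => expR (t * x i)), spec V (fun i => expR (t * y i))).
  rewrite eG; split.
    by split; apply: (spec_unit _ _).1 => // i; rewrite lt0r_neq0 ?expR_gt0.
  move=> P SP.
  apply: (@expsum_eq0 _ (fun t => mpoly.meval (coords (spec U (fun i => expR (t * x i)), spec V (fun i => expR (t * y i)))) P)).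
    apply: closed_meval; [exact: expsum_cst|exact: expsumD|exact: expsumM|].
    move=> i; have [[a [b e]]|[a [b e]]] := coordsP R i.
      by under eq_fun do rewrite e; apply: expsum_spec.
    by under eq_fun do rewrite e; apply: expsum_spec.
  by move=> k; have := Gk k; rewrite eG => -[_ ->].
have LH : iLieK G (spec U x, spec V y).
  split; last by split; apply: spec_herm.
  by move=> t /=; rewrite !expmx_specZ.
have half : iLieK G (spec U (fun i => 2^-1 * x i), spec V (fun i => 2^-1 * y i)).
  have /str[_ _ m1 m2] := LH.
  by apply/str; split; rewrite /= -?specZ; [rewrite specZ; exact: spec_herm|rewrite specZ; exact: spec_herm|exact: maskedZ|exact: maskedZ].
have key p (v X : 'M[C]_p) z : unitary X -> adj_mx v *m v = spec X (fun i => expR (z i)) ->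
    exists2 k, unitary k & v = k *m expmx (spec X (fun i => 2^-1 * z i)).
  move=> hX ev; exists (v *m spec X (fun i => expR (- (2^-1 * z i)))).
    rewrite /unitary adj_mxM (spec_herm X) mulmxA -[_ *m v]mulmxA ev !spec_mul //.
    rewrite -(spec1 hX); apply: eq_spec => i.
    by rewrite -!expRD -[RHS]expR0; congr expR; lra.
  rewrite expmx_spec // -mulmxA spec_mul // (@eq_spec _ _ _ _ (fun=> 1)) ?spec1 ?mulmx1 // => i.
  by rewrite -expRD addNr expR0.
have [k1 hk1 e1] := key _ _ _ _ hU eU; have [k2 hk2 e2] := key _ _ _ _ hV eV.
by exists k1, k2, (spec U (fun i => 2^-1 * x i), spec V (fun i => 2^-1 * y i)).
Qed.

End Blocks.

(** * Scalar inequalities *)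

Section Scalar.
Variable R : realType.

(** The quotient [f] of the quadratic by the exponential has derivative
    [exp(-t) * t * (3/5 - 4/5 t)]: it decreases before [0] and increases up to [3/4], so its minimum
    on the interval is [f 0 = 1]. *)
Lemma expR_le_quadratic (u : R) : `|u| <= 3 / 4 -> expR u <= 1 + u + 4 / 5 * u ^+ 2.
Proof.
move=> hu; have [u1 u2] : - (3 / 4) <= u /\ u <= 3 / 4.
  by move: hu; rewrite ler_norml => /andP[].
pose f (t : R) := expR (- t) * (1 + t + 4 / 5 * t ^+ 2).
pose df (t : R) := expR (- t) * (t * (3 / 5 - 4 / 5 * t)).
have fd (t : R) : is_derive t 1 f (df t).
  rewrite /f /df; apply: is_derive_eq.
  change (expR (- t) * (0 + 1 + 4 / 5 * (t * 1 + t * 1)) +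
    (1 + t + 4 / 5 * t ^+ 2) * (expR (- t) * -1) = expR (- t) * (t * (3 / 5 - 4 / 5 * t))).
  by field.
have fc (a b : R) : {within `[a, b], continuous f}.
  by apply: continuous_subspaceT => t; apply: differentiable_continuous; apply/derivable1_diffP; apply: (@ex_derive _ _ _ _ _ _ _ (fd t)).
have f0 : f 0 = 1 by rewrite /f oppr0 expR0; ring.
suff : 1 <= f u.
  by rewrite /f expRN mulrC ler_pdivlMr ?expR_gt0 // mul1r.
have [u0|u0|->] := ltgtP u 0; last by rewrite f0.
  have [c] := MVT u0 (fun t _ => fd t) (fc _ _).
  rewrite in_itv /= f0 => /andP[c1 c2] h.
  have := expR_gt0 (- c) => e0.
  have : df c * (0 - u) <= 0.
    rewrite /df -mulrA; apply: mulr_ge0_le0; first exact: ltW.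
    nra.
  lra.
have [c] := MVT u0 (fun t _ => fd t) (fc _ _).
rewrite in_itv /= f0 => /andP[c1 c2] h.
have := expR_gt0 (- c) => e0.
have : 0 <= df c * (u - 0).
  rewrite /df -mulrA; apply: mulr_ge0; first exact: ltW.
  nra.
lra.
Qed.

(* Shrink every gap of length [> 1] between consecutive values to a gap of length [1]. *)
Lemma gap_truncation (l : seq R) : sorted (fun a b => b < a) l ->
  exists tau : R -> R, forall v w, v \in l -> w \in l -> v <= w ->
    [/\ 0 <= tau w - tau v, tau w - tau v <= w - v,
        tau w - tau v <= (size l).-1%:R &
        w - v <= tau w - tau v \/ 1 <= tau w - tau v].
Proof.
elim: l => [|a [|b l] IH] /=; first by exists id.
  move=> _; exists id => v w; rewrite !inE => /eqP -> /eqP -> _.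
  by rewrite subrr; split=> //; left.
move=> /andP[ba sl]; have [tau ht] := IH sl.
have ltb : all (fun v => v < b) l.
  by apply: order_path_min sl => x y z /= h1 h2; apply: lt_trans h2 h1.
have leb v : v \in b :: l -> v <= b.
  by rewrite inE => /orP[/eqP -> //|/(allP ltb)/ltW].
pose tau' v := if v == a then tau b + Order.min (a - b) 1 else tau v.
have tE v : v \in b :: l -> tau' v = tau v.
  by move=> /leb vb; rewrite /tau' lt_eqF // (le_lt_trans vb ba).
have ta : tau' a = tau b + Order.min (a - b) 1 by rewrite /tau' eqxx.
have min0 : 0 <= Order.min (a - b) 1 by rewrite le_min ler01 andbT subr_ge0 ltW.
have min1 : Order.min (a - b) 1 <= a - b by rewrite ge_min lexx.
have min2 : Order.min (a - b) 1 <= 1 by rewrite ge_min lexx orbT.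
have min3 : a - b <= Order.min (a - b) 1 \/ 1 <= Order.min (a - b) 1.
  by rewrite !le_min !lexx andbT /=; case: (lerP (a - b) 1) => h; [left|right; exact: ltW].
exists tau' => v w; rewrite [v \in _]inE [w \in _]inE.
have sz : (size l).+1%:R = (size l)%:R + 1 :> R by rewrite natr1.
case/orP=> [/eqP ->|vl]; case/orP => [/eqP ->|wl].
- by move=> _; rewrite !subrr; split=> //; left.
- by move=> aw; have := lt_le_trans ba aw; rewrite ltNge leb.
- move=> _; rewrite ta (tE _ vl).
  have [h1 h2 h3 h4] := ht v b vl (mem_head _ _) (leb _ vl).
  split; rewrite ?sz; [lra|lra|lra|].
  by case: min3; case: h4 => *; [left|right|right|right]; lra.
move=> vw; rewrite !tE //; have [h1 h2 h3 h4] := ht v w vl wl vw.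
by split=> //; rewrite sz; lra.
Qed.

(** For [v <= w], either no gap between them was shrunk and the claim is [1 + t <= exp t], or the
    truncated difference is at least [1] and the left side is nonpositive. For [v > w], truncation
    only lowers the left side. *)
Lemma potential_truncation (s : seq R) : exists tau : R -> R,
  [/\ tau 0 = 0, forall v, v \in s -> tau v ^+ 2 <= (size s)%:R ^+ 2 &
      forall v w, v \in s -> w \in s -> 1 + (tau v - tau w) <= expR (v - w)].
Proof.
(* Adjoining [0] allows the normalisation [tau 0 = 0]; there are then at most [size s] gaps, each of
   truncated length at most [1]. *)
pose l := rev (sort <=%O (undup (0 :: s))).
have sl : sorted (fun a b => b < a) l.
  by rewrite rev_sorted lt_sorted_uniq_le sort_uniq undup_uniq sort_le_sorted.
have szl : (size l <= (size s).+1)%N by rewrite size_rev size_sort (leq_trans (size_undup _)).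
have ml v : v \in 0 :: s -> v \in l by rewrite mem_rev mem_sort mem_undup.
have [tau ht] := gap_truncation sl.
have sz : (size l).-1%:R <= (size s)%:R :> R by rewrite ler_nat -ltnS (leq_trans _ szl) // prednK // lt0n; apply/eqP => /size0nil l0; have := ml 0 (mem_head _ _); rewrite l0.
have m0 := ml 0 (mem_head _ _).
have ms v : v \in s -> v \in l by move=> h; apply: ml; rewrite inE h orbT.
exists (fun v => tau v - tau 0); split; first by rewrite subrr.
  move=> v /ms vl; have s0 : 0 <= (size s)%:R :> R by [].
  have [v0|v0] := leP v 0.
    by have [h1 h2 h3 _] := ht v 0 vl m0 v0; nra.
  by have [h1 h2 h3 _] := ht 0 v m0 vl (ltW v0); nra.
move=> v w /ms vl /ms wl; have e0 := expR_ge0 (v - w); have e1 := expR_ge1Dx (v - w).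
have [vw|vw] := leP v w.
  by have [h1 h2 h3 [h4|h4]] := ht v w vl wl vw; lra.
by have [h1 h2 h3 _] := ht w v wl vl (ltW vw); lra.
Qed.

(** * Weighted log-sum-exp: slope, descent and gap *)

Section Finite.
Variables (E : finType) (al be : E -> R).
Hypotheses (al0 : forall e, 0 <= al e) (be0 : forall e, 0 <= be e)
  (sal : 0 < \sum_e al e) (sbe : 0 < \sum_e be e).

(** The weights will be squared moduli of matrix entries and [d] the differences [x_i - y_j]; the
    factor [2^-1] turns squared norms into norms. *)
Definition logcost (d : E -> R) : R :=
  2^-1 * ln (\sum_e al e * expR (2 * d e)) + 2^-1 * ln (\sum_e be e * expR (- (2 * d e))).

Definition slope (d : E -> R) : R :=
  (\sum_e al e * d e) / (\sum_e al e) - (\sum_e be e * d e) / (\sum_e be e).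

Lemma sum_expR_gt0 (w d : E -> R) : (forall e, 0 <= w e) -> 0 < \sum_e w e ->
  0 < \sum_e w e * expR (d e).
Proof.
move=> w0 sw; rewrite lt_neqAle sumr_ge0 ?andbT; last by move=> e _; rewrite mulr_ge0 ?expR_ge0.
apply/negP => /eqP/esym/psumr_eq0P h; move: sw; rewrite big1 ?ltxx // => e _.
have := h (fun e _ => mulr_ge0 (w0 e) (expR_ge0 _)) e isT => /eqP.
by rewrite mulf_eq0 expR_eq0 orbF => /eqP.
Qed.

Lemma logcost0 : logcost (fun=> 0) = 2^-1 * ln (\sum_e al e) + 2^-1 * ln (\sum_e be e).
Proof.
rewrite /logcost; congr (_ * ln _ + _ * ln _); apply: eq_bigr => e _;
  by rewrite mulr0 ?oppr0 expR0 mulr1.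
Qed.

Lemma is_derive_sum_expR (w d : E -> R) (c : R) :
  is_derive (0 : R) (1 : R) (fun t => \sum_e w e * expR (c * (t * d e))) (\sum_e w e * (c * d e)).
Proof.
have h e : is_derive (0 : R) (1 : R) (fun t : R => w e * expR (c * (t * d e))) (w e * (c * d e)).
  apply: is_derive_eq; rewrite /GRing.scale /= mul0r mulr0 expR0; ring.
elim: (index_enum E) => [|e s IH].
  rewrite (_ : (fun t => _) = cst 0); last by apply/funext => t; rewrite big_nil.
  by rewrite big_nil; exact: is_derive_cst.
rewrite big_cons (_ : (fun t => _) = (fun t => w e * expR (c * (t * d e))) +
  (fun t => \sum_(e <- s) w e * expR (c * (t * d e)))); last first.
  by apply/funext => t; rewrite big_cons.
exact: is_deriveD.
Qed.

Lemma is_derive_logcost (d : E -> R) :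
  is_derive (0 : R) (1 : R) (fun t => logcost (fun e => t * d e)) (slope d).
Proof.
have at0 (w : E -> R) c : \sum_e w e * expR (c * (0 * d e)) = \sum_e w e.
  by apply: eq_bigr => e _; rewrite mul0r mulr0 expR0 mulr1.
have hln (w : E -> R) c : 0 < \sum_e w e ->
    is_derive (0 : R) (1 : R) (fun t => ln (\sum_e w e * expR (c * (t * d e))))
      ((\sum_e w e)^-1 * (\sum_e w e * (c * d e))).
  move=> sw; apply: (@is_derive1_comp _ (@ln R) (fun t => \sum_e w e * expR (c * (t * d e)))).
    by rewrite at0; apply: is_derive1_ln.
  exact: is_derive_sum_expR.
have ha := hln al 2 sal; have hb := hln be (- 2) sbe.
rewrite (_ : (fun t => _) = (2^-1 *: (fun t => ln (\sum_e al e * expR (2 * (t * d e))))) +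
   (2^-1 *: (fun t => ln (\sum_e be e * expR (- 2 * (t * d e)))))); last first.
  apply/funext => t; rewrite /logcost; congr (_ + _ * ln _).
  by apply: eq_bigr => e _; rewrite mulNr.
apply: (is_derive_eq (is_deriveD (is_deriveZ _ ha) (is_deriveZ _ hb))).
change (2^-1 * ((\sum_e al e)^-1 * \sum_e al e * (2 * d e)) +
  2^-1 * ((\sum_e be e)^-1 * \sum_e be e * (-2 * d e)) = slope d).
have out (w : E -> R) c : \sum_e w e * (c * d e) = c * \sum_e w e * d e.
  by rewrite mulr_sumr; apply: eq_bigr => e _; rewrite mulrCA.
rewrite !out /slope; field.
by rewrite !lt0r_neq0.
Qed.

(** The slope is the mean of [d e - d e'] under the product of the two normalised weights. *)
Lemma slope_le (d : E -> R) c : (forall e e', d e - d e' <= c) -> slope d <= c.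
Proof.
move=> hc; rewrite /slope.
have h : \sum_e al e * d e * (\sum_e' be e') - (\sum_e' be e' * d e') * (\sum_e al e) <= c * (\sum_e al e) * (\sum_e be e).
  rewrite -!mulr_suml.
  rewrite mulr_suml [(\sum_e' _ * _) * _]mulrC mulr_suml -sumrB -mulrA mulr_suml mulr_sumr.
  apply: ler_sum => e _; rewrite !mulr_sumr -sumrB; apply: ler_sum => e' _.
  have := ler_wpM2l (mulr_ge0 (al0 e) (be0 e')) (hc e e'); lra.
rewrite -(ler_pM2r (mulr_gt0 sal sbe)).
apply: le_trans (_ : c * (\sum_e al e) * (\sum_e be e) <= _); last by rewrite mulrA.
apply: le_trans h; rewrite le_eqVlt; apply/orP; left; apply/eqP.
rewrite -mulr_suml; field.
by rewrite !lt0r_neq0.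
Qed.

(** For [d] coming from the gradient, [q = slope d] is its squared norm. The step gains [q / 8] at
    first order; the two logarithms, each with weight [1/2], lose at most [q / 10] each, leaving
    [q / 8 - q / 10 = q / 40]. *)
Lemma slope_descent (d : E -> R) : (forall e, d e ^+ 2 <= 2 * slope d) ->
  (forall e e', (d e - d e') ^+ 2 <= 4 * slope d) -> 0 <= slope d ->
  logcost (fun e => - (1 / 8) * d e) <= logcost (fun=> 0) - slope d / 40.
Proof.
move=> h1 h2 h0; set q := slope d in h1 h2 h0 *.
pose s := Num.sqrt q; have s0 : 0 <= s by rewrite sqrtr_ge0.
have sq : s ^+ 2 = q by rewrite sqr_sqrtr.
(* A self-bounding estimate: it gives [q <= 4], so [(c * d e)^2 <= q / 8 <= 1/2 < 9/16] and the
   quadratic bound on the exponential applies. *)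
have q2 : q <= 2 * s.
  by apply: slope_le => e e'; have := h2 e e'; rewrite -sq => ?; nra.
have s2 : s <= 2 by rewrite -sq in q2; nra.
have q4 : q <= 4 by rewrite -sq; nra.
have ex (c : R) e : c ^+ 2 = 1 / 16 -> expR (c * d e) <= 1 + c * d e + q / 10.
  move=> hc; have hd := h1 e.
  have hcd : (c * d e) ^+ 2 <= q / 8 by rewrite exprMn hc; lra.
  apply: le_trans (expR_le_quadratic _) _; last by lra.
  by rewrite ler_norml; apply/andP; split; nra.
have bound (w : E -> R) (c : R) : (forall e, 0 <= w e) -> 0 < \sum_e w e -> c ^+ 2 = 1 / 16 ->
    ln (\sum_e w e * expR (c * d e)) <= ln (\sum_e w e) + c * ((\sum_e w e * d e) / \sum_e w e) + q / 10.
  move=> w0 sw hc; have sE := sum_expR_gt0 (fun e => c * d e) w0 sw.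
  have hle : (\sum_e w e * expR (c * d e)) / (\sum_e w e) <= 1 + (c * ((\sum_e w e * d e) / \sum_e w e) + q / 10).
    rewrite ler_pdivrMr //.
    apply: le_trans (_ : \sum_e w e * (1 + c * d e + q / 10) <= _).
      by apply: ler_sum => e _; apply: ler_wpM2l => //; apply: ex.
    rewrite le_eqVlt; apply/orP; left; apply/eqP.
    under eq_bigr do rewrite !mulrDr mulr1 mulrCA.
    rewrite !big_split /= -mulr_sumr -mulr_suml; field.
    by rewrite lt0r_neq0.
  have p0 : 0 < (\sum_e w e * expR (c * d e)) / (\sum_e w e) by rewrite divr_gt0.
  have hln : ln ((\sum_e w e * expR (c * d e)) / (\sum_e w e)) <= c * ((\sum_e w e * d e) / \sum_e w e) + q / 10.
    apply: le_trans (_ : ln (1 + (c * ((\sum_e w e * d e) / \sum_e w e) + q / 10)) <= _).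
      by rewrite ler_ln ?posrE // (lt_le_trans p0).
    by apply: le_ln1Dx; lra.
  by move: hln; rewrite ln_div ?posrE //; lra.
rewrite logcost0 /logcost.
have c16 : (- (1 / 4) : R) ^+ 2 = 1 / 16 by field.
have d16 : (1 / 4 : R) ^+ 2 = 1 / 16 by field.
have b1 := bound al (- (1 / 4)) al0 sal c16.
have b2 := bound be (1 / 4) be0 sbe d16.
have -> : \sum_e al e * expR (2 * (- (1 / 8) * d e)) = \sum_e al e * expR (- (1 / 4) * d e).
  by apply: eq_bigr => e _; congr (_ * expR _); field.
have -> : \sum_e be e * expR (- (2 * (- (1 / 8) * d e))) = \sum_e be e * expR (1 / 4 * d e).
  by apply: eq_bigr => e _; congr (_ * expR _); field.
have : q = (\sum_e al e * d e) / (\sum_e al e) - (\sum_e be e * d e) / (\sum_e be e) by [].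
by lra.
Qed.

(* The shift [s] balances the two sums, so that their geometric mean is the arithmetic mean. *)
Lemma logcost_gap (d : E -> R) : exists s, forall d' : E -> R,
  (forall e, 1 + d' e <= expR (2 * d e + s)) ->
  (forall e, 1 - d' e <= expR (- (2 * d e + s))) ->
  1 + slope d' / 2 <= expR (logcost d - logcost (fun=> 0)).
Proof.
set P := (\sum_e al e * expR (2 * d e)) / \sum_e al e.
set Q := (\sum_e be e * expR (- (2 * d e))) / \sum_e be e.
have Pp : 0 < \sum_e al e * expR (2 * d e) by apply: sum_expR_gt0.
have Qp : 0 < \sum_e be e * expR (- (2 * d e)) by apply: sum_expR_gt0.
have P0 : 0 < P by rewrite divr_gt0.
have Q0 : 0 < Q by rewrite divr_gt0.
exists ((ln Q - ln P) / 2) => d' h1 h2; set s := (ln Q - ln P) / 2 in h1 h2.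
have lhs : logcost d - logcost (fun=> 0) = (ln P + ln Q) / 2.
  by rewrite logcost0 /logcost /P /Q !ln_div ?posrE //; field.
have eP : expR (logcost d - logcost (fun=> 0)) = P * expR s.
  by rewrite lhs -{2}(lnK (x := P)) ?posrE // -expRD; congr expR; rewrite /s; field.
have eQ : expR (logcost d - logcost (fun=> 0)) = Q * expR (- s).
  by rewrite lhs -{2}(lnK (x := Q)) ?posrE // -expRD; congr expR; rewrite /s; field.
have b1 : 1 + (\sum_e al e * d' e) / (\sum_e al e) <= P * expR s.
  rewrite /P mulrAC ler_pdivlMr // mulrDl mul1r divfK ?lt0r_neq0 // mulr_suml -big_split /=.
  apply: ler_sum => e _; rewrite -mulrA -expRD.
  by apply: le_trans (ler_wpM2l (al0 e) (h1 e)); rewrite mulrDr mulr1.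
have b2 : 1 - (\sum_e be e * d' e) / (\sum_e be e) <= Q * expR (- s).
  rewrite /Q mulrAC ler_pdivlMr // mulrBl mul1r divfK ?lt0r_neq0 // mulr_suml -sumrB /=.
  apply: ler_sum => e _; rewrite -mulrA -expRD -opprD.
  by apply: le_trans (ler_wpM2l (be0 e) (h2 e)); rewrite mulrBr mulr1.
by rewrite -eP in b1; rewrite -eQ in b2; rewrite /slope; lra.
Qed.

End Finite.
(** Here [kg] and [kh] are the values at the current point and at a near-optimal competitor, [ks] is
    the infimum, [s = <D, T>], [t = |T|^2] and [d = |D|^2]. Cauchy-Schwarz enters in Young form,
    free of square roots. *)
Lemma norm_of_gap (kg kh ks N eps s t d : R) : 0 < kg -> 0 < ks -> 0 < N ->
  0 < eps -> eps < 1 / 2 -> eps <= ln kg - ln ks -> kh < ks + ks * (eps / 24) ->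
  t <= N -> 1 + s / 2 <= kh / kg -> (forall l, 0 < l -> - s <= (l * d + t / l) / 2) ->
  eps ^+ 2 <= N * d.
Proof.
move=> kg0 ks0 N0 e0 e1 hgap hh tN hD young.
have kge : ks * (1 + eps) <= kg.
  have : expR eps <= expR (ln kg - ln ks) by rewrite ler_expR.
  rewrite expRB !lnK ?posrE // ler_pdivlMr // => h1; apply: le_trans h1.
  by rewrite mulrC ler_pM2r //; apply: expR_ge1Dx.
(* The slack [eps / 24] is affordable: [(1 - 5/8 eps) * (1 + eps) >= 1 + eps / 24] as long as
   [eps <= 8/15]. *)
have hr : kh / kg <= 1 - 5 / 8 * eps.
  rewrite ler_pdivrMr //.
  apply: le_trans (_ : (1 - 5 / 8 * eps) * (ks * (1 + eps)) <= _); last first.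
    by apply: ler_wpM2l => //; lra.
  apply: le_trans (ltW hh) _.
  have -> : ks + ks * (eps / 24) = ks * (1 + eps / 24) by ring.
  rewrite mulrCA ler_pM2l //; nra.
(* The parameter [l = N / eps] makes [t / l <= eps], which is absorbed by [- s >= 5/4 eps]. *)
have l0 : 0 < N / eps by rewrite divr_gt0.
have := young _ l0.
have te : t / (N / eps) <= eps.
  by rewrite ler_pdivrMr // mulrCA divff ?lt0r_neq0 // mulr1.
have -> : N / eps * d = N * d / eps by rewrite mulrAC.
move=> hY; have : 3 / 2 * eps <= N * d / eps by lra.
rewrite ler_pdivlMr // => h3; nra.
Qed.

(** If the gap were still [eps] at time [T], monotonicity would make it at least [eps] at all
    earlier times, and [T] decreases of [eps^2 / (320 M)] would exhaust the initial gap. *)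
Lemma descent_rate (f d : nat -> R) (M eps fs : R) (T : nat) : 0 < M -> 0 < eps ->
  (forall k, f k.+1 <= f k - d k / 40) -> (forall k, 0 <= d k) ->
  (forall k, eps <= f k - fs -> eps ^+ 2 <= 8 * M * d k) ->
  320 * M * (f 0%N - fs) / eps ^+ 2 <= T%:R -> f T - fs < eps.
Proof.
move=> M0 e0 fd d0 hd hT; rewrite ltNge; apply/negP => hgap.
have mono k j : f (k + j)%N <= f k.
  elim: j => [|j IH]; first by rewrite addn0.
  by rewrite addnS; apply: le_trans IH; have := fd (k + j)%N; have := d0 (k + j)%N; lra.
set q := eps ^+ 2 / (320 * M).
have M320 : 0 < 320 * M by apply: mulr_gt0 M0; rewrite ltr0n.
have dec k : (k <= T)%N -> f k <= f 0%N - k%:R * q.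
  elim: k => [_|k IH kT]; first by rewrite mul0r subr0.
  have fT : f T <= f k by have := mono k (T - k)%N; rewrite subnKC // ltnW.
  have hk : eps <= f k - fs by lra.
  have hq : q <= d k / 40.
    rewrite /q ler_pdivrMr //; apply: le_trans (hd _ hk) _.
    by have -> : d k / 40 * (320 * M) = 8 * M * d k by field.
  by have := IH (ltnW kT); have := fd k; rewrite -[k.+1%:R]natr1 mulrDl mul1r; lra.
have := dec T (leqnn T).
have : f 0%N - fs <= T%:R * q.
  move: hT; rewrite ler_pdivrMr ?exprn_gt0 // => hT.
  by rewrite /q mulrA ler_pdivlMr // mulrC.
lra.
Qed.

End Scalar.

(** * The cost along a geodesic *)

Section Weights.
Variable R : realType.
Local Notation C := R[i].

Lemma sqn_conj (z : C) : sqn (conjc z) = sqn z.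
Proof. by case: z => a b; rewrite /sqn /= sqrrN. Qed.

Lemma sqnM_rC (s t : R) (z : C) : sqn (rC s * z * rC t) = sqn z * (s * t) ^+ 2.
Proof. by case: z => a b; rewrite /sqn /=; ring. Qed.

Definition frob2 p q (M : 'M[C]_(p, q)) : R := \sum_i \sum_j sqn (M i j).

Lemma frob2_ge0 p q (M : 'M[C]_(p, q)) : 0 <= frob2 M.
Proof. by do 2!apply: sumr_ge0 => ? _; apply: sqn_ge0. Qed.

Lemma frob2_gt0 p q (M : 'M[C]_(p, q)) : M != 0 -> 0 < frob2 M.
Proof.
move=> M0; rewrite lt_neqAle frob2_ge0 andbT; apply: contraNneq M0 => /esym h.
apply/eqP/matrixP => i j; rewrite mxE; apply: sqn_eq0.
have hi : \sum_j sqn (M i j) = 0.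
  by apply: (psumr_eq0P _ h) => // k _; apply: sumr_ge0 => *; apply: sqn_ge0.
by apply: (psumr_eq0P _ hi) => // *; apply: sqn_ge0.
Qed.

Lemma ln_frob p q (M : 'M[C]_(p, q)) : ln (frob M) = 2^-1 * ln (frob2 M).
Proof.
have -> : frob M = Num.sqrt (frob2 M) by [].
by rewrite -powR12_sqrt ?frob2_ge0 // ln_powR.
Qed.

Lemma unitary_adj p (U : 'M[C]_p) : unitary U -> unitary (adj_mx U).
Proof. by move=> h; rewrite /unitary adj_mxK unitaryV. Qed.

Lemma unitary1 p : unitary (1%:M : 'M[C]_p).
Proof. by rewrite /unitary adj_mx1 mulmx1. Qed.

Lemma mxtrace_spec p (U : 'M[C]_p) x : unitary U -> \tr (spec U x) = rC (\sum_i x i).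
Proof.
move=> /unitaryV hU; rewrite /spec mxtrace_mulC mulmxA hU mul1mx mxtrace_diag rmorph_sum.
by apply: eq_bigr => i _; rewrite mxE.
Qed.

(** The unitary [V] is arbitrary because row norms ignore it; choosing it as the eigenbasis of the
    other component lets one array of weights serve rows and columns. *)
Lemma trace_row_weight p q (A : 'M[C]_(p, q)) U V x : unitary U -> unitary V ->
  \tr (A *m adj_mx A *m spec U x) =
  rC (\sum_i \sum_j sqn ((U *m A *m adj_mx V) i j) * x i).
Proof.
move=> hU hV; set A' := U *m A *m adj_mx V.
have e : A' *m adj_mx A' = U *m (A *m adj_mx A) *m adj_mx U.
  rewrite /A' !adj_mxM adj_mxK !mulmxA -[_ *m adj_mx V *m V]mulmxA hV mulmx1.
  by rewrite -!mulmxA.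
rewrite /spec mulmxA mxtrace_mulC !mulmxA -[U *m A *m _]mulmxA -e mul_mx_diag /mxtrace rmorph_sum.
apply: eq_bigr => i _; rewrite !mxE mulr_suml rmorph_sum; apply: eq_bigr => j _.
transitivity (rC (sqn (A' i j)) * rC (x i)); last exact: esym (rmorphM (@rC R) _ _).
by rewrite adj_mxE -conj_mul_sqn [A' i j * _]mulrC.
Qed.

Lemma trace_col_weight p q (A : 'M[C]_(p, q)) U V y : unitary U -> unitary V ->
  \tr (adj_mx A *m A *m spec V y) =
  rC (\sum_i \sum_j sqn ((U *m A *m adj_mx V) i j) * y j).
Proof.
move=> hU hV; rewrite -{2}(adj_mxK A) (trace_row_weight _ _ hV hU) exchange_big /=.
congr rC; apply: eq_bigr => i _; apply: eq_bigr => j _.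
by rewrite -sqn_conj -adj_mxE !adj_mxM !adj_mxK mulmxA.
Qed.

Lemma frob2_unitary p q (A : 'M[C]_(p, q)) U V : unitary U -> unitary V ->
  frob2 (U *m A *m adj_mx V) = frob2 A.
Proof.
have h (X : 'M[C]_p) (Y : 'M[C]_q) : unitary X -> unitary Y ->
    \tr (A *m adj_mx A) = rC (frob2 (X *m A *m adj_mx Y)).
  move=> hX hY; rewrite -[A *m adj_mx A]mulmx1 -(spec1 hX) (trace_row_weight _ _ hX hY).
  by congr rC; apply: eq_bigr => i _; apply: eq_bigr => j _; rewrite mulr1.
move=> hU hV; suff : rC (frob2 (U *m A *m adj_mx V)) = rC (frob2 A).
  by move/(fmorph_inj (@rC R)).
by rewrite -h //; rewrite (h _ _ (unitary1 _) (unitary1 _)) adj_mx1 mulmx1 mul1mx.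
Qed.

Lemma frob2_spec p q (A : 'M[C]_(p, q)) U V a b : unitary U -> unitary V ->
  frob2 (spec U a *m A *m spec V b) =
  \sum_i \sum_j sqn ((U *m A *m adj_mx V) i j) * (a i * b j) ^+ 2.
Proof.
move=> hU hV; set A' := U *m A *m adj_mx V.
have -> : spec U a *m A *m spec V b =
   adj_mx U *m (diag_mx (\row_i rC (a i)) *m A' *m diag_mx (\row_i rC (b i))) *m adj_mx (adj_mx V).
  by rewrite adj_mxK /spec /A' !mulmxA.
rewrite frob2_unitary; [|exact: unitary_adj|exact: unitary_adj].
apply: eq_bigr => i _; apply: eq_bigr => j _.
by rewrite mul_mx_diag mul_diag_mx !mxE sqnM_rC.
Qed.

Section Pair.
Variables m n : nat.
Implicit Types (A : 'M[C]_(m, n)) (B : 'M[C]_(n, m)) (U : 'M[C]_m) (V : 'M[C]_n).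

Definition wtA U V A (e : 'I_m * 'I_n) : R := sqn ((U *m A *m adj_mx V) e.1 e.2).
(** The indices are transposed so that both weights live on the same pairs [(i, j)] and their
    exponents differ only in sign. *)
Definition wtB U V B (e : 'I_m * 'I_n) : R := sqn ((V *m B *m adj_mx U) e.2 e.1).
Definition drop_of (x : 'I_m -> R) (y : 'I_n -> R) (e : 'I_m * 'I_n) : R := x e.1 - y e.2.

Lemma wtA_ge0 U V A e : 0 <= wtA U V A e. Proof. exact: sqn_ge0. Qed.
Lemma wtB_ge0 U V B e : 0 <= wtB U V B e. Proof. exact: sqn_ge0. Qed.

Lemma wtA_sum U V A : unitary U -> unitary V -> \sum_e wtA U V A e = frob2 A.
Proof. by move=> hU hV; rewrite -(frob2_unitary A hU hV) /frob2 pair_bigA. Qed.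

Lemma wtB_sum U V B : unitary U -> unitary V -> \sum_e wtB U V B e = frob2 B.
Proof.
by move=> hU hV; rewrite -(frob2_unitary B hV hU) /frob2 exchange_big pair_bigA.
Qed.

Definition base A B (g : 'M[C]_m * 'M[C]_n) : 'M[C]_(m, n) * 'M[C]_(n, m) :=
  (g.1 *m A *m invmx g.2, g.2 *m B *m invmx g.1).

Lemma invmx_mul p (M N : 'M[C]_p) : M \in unitmx -> N \in unitmx ->
  invmx (M *m N) = invmx N *m invmx M.
Proof.
move=> uM uN; have u : M *m N \in unitmx by rewrite unitmx_mul uM.
by rewrite -[RHS]mulmx1 -(mulmxV u) !mulmxA -[_ *m invmx M *m M]mulmxA mulVmx // mulmx1 mulVmx // mul1mx.
Qed.

Lemma unitmx_mul_neq0 p q (X : 'M[C]_p) (A : 'M[C]_(p, q)) (Y : 'M[C]_q) :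
  X \in unitmx -> Y \in unitmx -> A != 0 -> X *m A *m invmx Y != 0.
Proof.
move=> uX uY; apply: contraNneq => h.
by rewrite -[A](mulKmx uX) -[X *m A](mulmxKV uY) h mul0mx mulmx0.
Qed.

Lemma costAB_spec A B g U V x y : GLpair g -> unitary U -> unitary V ->
  costAB A B (spec U (fun i => expR (x i)) *m g.1, spec V (fun i => expR (y i)) *m g.2) =
  logcost (wtA U V (base A B g).1) (wtB U V (base A B g).2) (drop_of x y).
Proof.
move=> [ug1 ug2] hU hV.
have [uU eU] : spec U (fun i => expR (x i)) \in unitmx /\
    invmx (spec U (fun i => expR (x i))) = spec U (fun i => (expR (x i))^-1).
  by apply: spec_unit => // i; rewrite lt0r_neq0 ?expR_gt0.
have [uV eV] : spec V (fun i => expR (y i)) \in unitmx /\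
    invmx (spec V (fun i => expR (y i))) = spec V (fun i => (expR (y i))^-1).
  by apply: spec_unit => // i; rewrite lt0r_neq0 ?expR_gt0.
rewrite /costAB /= (invmx_mul uU ug1) (invmx_mul uV ug2) eU eV.
have -> : spec U (fun i => expR (x i)) *m g.1 *m A *m (invmx g.2 *m spec V (fun i => (expR (y i))^-1)) =
   spec U (fun i => expR (x i)) *m (base A B g).1 *m spec V (fun i => (expR (y i))^-1).
  by rewrite /base /= !mulmxA.
have -> : spec V (fun i => expR (y i)) *m g.2 *m B *m (invmx g.1 *m spec U (fun i => (expR (x i))^-1)) =
   spec V (fun i => expR (y i)) *m (base A B g).2 *m spec U (fun i => (expR (x i))^-1).
  by rewrite /base /= !mulmxA.
rewrite !ln_frob !frob2_spec // /logcost; congr (_ * ln _ + _ * ln _).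
  rewrite pair_bigA; apply: eq_bigr => e _; congr (_ * _).
  by rewrite -expRN -expRD expr2 -expRD; congr expR; rewrite /drop_of; ring.
rewrite exchange_big pair_bigA; apply: eq_bigr => e _; congr (_ * _).
by rewrite -expRN -expRD expr2 -expRD; congr expR; rewrite /drop_of; ring.
Qed.

Lemma costAB_base A B g U V : GLpair g -> unitary U -> unitary V ->
  costAB A B g = logcost (wtA U V (base A B g).1) (wtB U V (base A B g).2) (fun=> 0).
Proof.
move=> gl hU hV; have := costAB_spec A B (fun=> 0) (fun=> 0) gl hU hV.
rewrite (@eq_spec _ _ U _ (fun=> 1)) ?spec1 ?mul1mx; [|by []|by move=> i; rewrite expR0].
rewrite (@eq_spec _ _ V _ (fun=> 1)) ?spec1 ?mul1mx; [|by []|by move=> i; rewrite expR0].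
rewrite -surjective_pairing => ->; congr logcost.
by apply/funext => e; rewrite /drop_of subrr.
Qed.

(** The orthogonal projection onto matrices supported on [r]. *)
Definition restrict_mx p (r : 'I_p -> 'I_p -> Prop) (M : 'M[C]_p) : 'M[C]_p :=
  \matrix_(i, j) if `[< r i j >] then M i j else 0.

Lemma restrict_masked p r (M : 'M[C]_p) : masked r (restrict_mx r M).
Proof. by move=> i j; rewrite mxE; case: asboolP => // _; rewrite eqxx. Qed.

Lemma restrict_herm p (r : 'I_p -> 'I_p -> Prop) (M : 'M[C]_p) : (forall i j, r i j -> r j i) ->
  Defs.hermitian M -> Defs.hermitian (restrict_mx r M).
Proof.
move=> sr hM; apply/matrixP => i j; rewrite adj_mxE !mxE.
have -> : `[< r j i >] = `[< r i j >] by apply: asbool_equiv_eq; split; apply: sr.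
by case: ifP => _; [rewrite -adj_mxE hM|rewrite rmorph0].
Qed.

Lemma restrict_trace p r (M H : 'M[C]_p) : masked r H ->
  \tr (adj_mx (restrict_mx r M) *m H) = \tr (adj_mx M *m H).
Proof.
move=> hH; apply: eq_bigr => i _; rewrite !mxE; apply: eq_bigr => j _.
rewrite !adj_mxE mxE; case: asboolP => // nr.
by rewrite (maskedP0 hH nr) !mulr0.
Qed.

(** The moment map: the gradient at the identity for the full product of general linear groups.
    Projecting it to the allowed support gives the gradient for [G]. *)
Definition moment A B : 'M[C]_m * 'M[C]_n :=
  (rC (frob2 A)^-1 *: (A *m adj_mx A) - rC (frob2 B)^-1 *: (adj_mx B *m B),
   rC (frob2 B)^-1 *: (B *m adj_mx B) - rC (frob2 A)^-1 *: (adj_mx A *m A)).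

Lemma gram_herm p q (M : 'M[C]_(p, q)) t : Defs.hermitian (rC t *: (adj_mx M *m M)).
Proof. by rewrite /Defs.hermitian adj_mxZ conjc_rC adj_mxM adj_mxK. Qed.

Lemma moment_herm A B : Defs.hermitian (moment A B).1 /\ Defs.hermitian (moment A B).2.
Proof.
have h p q (M : 'M[C]_(p, q)) t : adj_mx (rC t *: (M *m adj_mx M)) = rC t *: (M *m adj_mx M).
  by rewrite adj_mxZ conjc_rC adj_mxM adj_mxK.
by split; rewrite /Defs.hermitian /= adj_mxB h gram_herm.
Qed.

Lemma mxtrace_subZ p (a b : C) (X Y Z : 'M[C]_p) :
  \tr ((a *: X - b *: Y) *m Z) = a * \tr (X *m Z) - b * \tr (Y *m Z).
Proof. by rewrite mulmxBl -!scalemxAl raddfB /= !mxtraceZ. Qed.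

Lemma moment_slope A B U V x y : unitary U -> unitary V ->
  ip (moment A B) (spec U x, spec V y) = slope (wtA U V A) (wtB U V B) (drop_of x y).
Proof.
move=> hU hV; have [h1 h2] := moment_herm A B.
rewrite /ip /= h1 h2 /= !mxtrace_subZ.
rewrite (trace_row_weight A x hU hV) (trace_col_weight B x hV hU).
rewrite (trace_row_weight B y hV hU) (trace_col_weight A y hU hV).
rewrite /slope wtA_sum // wtB_sum // -!rmorphM -!rmorphB -rmorphD /=.
have eA : \sum_e wtA U V A e * drop_of x y e =
   \sum_i \sum_j sqn ((U *m A *m adj_mx V) i j) * x i - \sum_i \sum_j sqn ((U *m A *m adj_mx V) i j) * y j.
  by rewrite !pair_bigA /= -sumrB; apply: eq_bigr => e _; rewrite -mulrBr.
have eB : \sum_e wtB U V B e * drop_of x y e =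
   \sum_i \sum_j sqn ((V *m B *m adj_mx U) i j) * x j - \sum_i \sum_j sqn ((V *m B *m adj_mx U) i j) * y i.
  rewrite exchange_big [X in _ - X]exchange_big !pair_bigA /= -sumrB.
  by apply: eq_bigr => e _; rewrite -mulrBr.
by rewrite eA eB; ring.
Qed.

(** * The gradient as a projected moment map, and one descent step *)

Section Gradient.
Variables (G : set ('M[C]_m * 'M[C]_n)) (r1 : 'I_m -> 'I_m -> Prop)
  (r2 : 'I_n -> 'I_n -> Prop) (A : 'M[C]_(m, n)) (B : 'M[C]_(n, m)).
Hypotheses (bG : block_structure G r1 r2) (A0 : A != 0) (B0 : B != 0).

Lemma wt_gt0 g U V : GLpair g -> unitary U -> unitary V ->
  0 < \sum_e wtA U V (base A B g).1 e /\ 0 < \sum_e wtB U V (base A B g).2 e.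
Proof.
by move=> [u1 u2] hU hV; rewrite wtA_sum // wtB_sum //; split; apply/frob2_gt0/unitmx_mul_neq0.
Qed.

Lemma cost_derive g U V x y : GLpair g -> unitary U -> unitary V ->
  is_derive (0 : R) (1 : R) (fun t => costAB A B (act t (spec U x, spec V y) g))
    (slope (wtA U V (base A B g).1) (wtB U V (base A B g).2) (drop_of x y)).
Proof.
move=> gl hU hV; have [sa sb] := wt_gt0 gl hU hV.
have := is_derive_logcost sa sb (drop_of x y).
rewrite (_ : (fun t => logcost _ _ _) = fun t => costAB A B (act t (spec U x, spec V y) g)) //.
apply/funext => t; rewrite /act /= !expmx_specZ // costAB_spec //; congr logcost.
by apply/funext => e; rewrite /drop_of mulrBr.
Qed.

(** Existence must be shown because [gradient] is a choice that falls back to [(0, 0)]. *)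
Lemma is_gradient_moment g : GLpair g -> exists D, is_gradient G (costAB A B) g D.
Proof.
move=> gl; have [_ [s1 _] [s2 _] str] := bG.
have [h1 h2] := moment_herm (base A B g).1 (base A B g).2.
exists (restrict_mx r1 (moment (base A B g).1 (base A B g).2).1,
        restrict_mx r2 (moment (base A B g).1 (base A B g).2).2).
split.
  by apply/str; split; [exact: restrict_herm|exact: restrict_herm|exact: restrict_masked|exact: restrict_masked].
move=> H HL; have /str[_ _ m1 m2] := HL.
rewrite /ip /= !restrict_trace // -/(ip (moment _ _) H).
have [U [x [V [y [hU hV -> _]]]]] := iLieK_curve HL.
by rewrite moment_slope //; apply: cost_derive.
Qed.

Lemma gradient_slope g : GLpair g ->
  iLieK G (gradient G (costAB A B) g) /\
  forall U V x y, unitary U -> unitary V -> iLieK G (spec U x, spec V y) ->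
   ip (gradient G (costAB A B) g) (spec U x, spec V y) =
   slope (wtA U V (base A B g).1) (wtB U V (base A B g).2) (drop_of x y).
Proof.
move=> gl; have [DL hD] := xgetPex (0, 0) (is_gradient_moment gl).
split=> // U V x y hU hV HL; have d1 := hD _ HL; have d2 := cost_derive x y gl hU hV.
by rewrite -(@derive_val _ _ _ _ _ _ _ d1) (@derive_val _ _ _ _ _ _ _ d2).
Qed.

Lemma ip_spec U V x y : unitary U -> unitary V ->
  ip (spec U x, spec V y) (spec U x, spec V y) = \sum_i x i ^+ 2 + \sum_j y j ^+ 2.
Proof.
move=> hU hV; rewrite /ip /= !spec_herm !spec_mul // !mxtrace_spec // -rmorphD /=.
Qed.

Lemma sqr_le_sum p (x : 'I_p -> R) i : x i ^+ 2 <= \sum_k x k ^+ 2.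
Proof. by rewrite (bigD1 i) //= lerDl sumr_ge0 // => k _; apply: sqr_ge0. Qed.

Lemma sqr_sub_le_sum p (x : 'I_p -> R) i j : (x i - x j) ^+ 2 <= 2 * \sum_k x k ^+ 2.
Proof.
have [->|ij] := eqVneq i j.
  by rewrite subrr expr0n mulr_ge0 // sumr_ge0 // => k _; apply: sqr_ge0.
have : x i ^+ 2 + x j ^+ 2 <= \sum_k x k ^+ 2.
  rewrite (bigD1 i) //= (bigD1 j) 1?eq_sym //= addrA lerDl sumr_ge0 // => k _.
  exact: sqr_ge0.
have := sqr_ge0 (x i + x j); lra.
Qed.

(** The gradient itself is diagonalised, so the slope along it is [q], the sum of all [x_i^2] and
    [y_j^2]. Then [(x_i - y_j)^2 <= 2 q], and two such differences differ by at most [2 sqrt q]. *)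
Lemma gradient_step_descent g D : GLpair g -> D = gradient G (costAB A B) g ->
  costAB A B (expmx (rC (- (1 / 8)) *: D.1) *m g.1, expmx (rC (- (1 / 8)) *: D.2) *m g.2)
    <= costAB A B g - ip D D / 40.
Proof.
move=> gl eqD; have [DL hD] := gradient_slope gl; rewrite -eqD in DL hD.
have [U [x [V [y [hU hV eD _]]]]] := iLieK_curve DL.
rewrite eD in DL.
have := hD _ _ _ _ hU hV DL; rewrite eD ip_spec // => hq.
have [sa sb] := wt_gt0 gl hU hV.
have x0 : 0 <= \sum_i x i ^+ 2 by apply: sumr_ge0 => *; apply: sqr_ge0.
have y0 : 0 <= \sum_i y i ^+ 2 by apply: sumr_ge0 => *; apply: sqr_ge0.
rewrite /= !expmx_specZ // costAB_spec // (costAB_base A B gl hU hV) hq.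
rewrite (_ : drop_of _ _ = fun e => - (1 / 8) * drop_of x y e); last first.
  by apply/funext => e; rewrite /drop_of mulrBr.
apply: slope_descent => //.
- exact: wtA_ge0.
- exact: wtB_ge0.
- move=> e; rewrite -hq /drop_of.
  have := sqr_le_sum x e.1; have := sqr_le_sum y e.2; have := sqr_ge0 (x e.1 + y e.2); lra.
- move=> e e'; rewrite -hq /drop_of.
  have := sqr_sub_le_sum x e.1 e'.1; have := sqr_sub_le_sum y e.2 e'.2.
  have := sqr_ge0 (x e.1 - x e'.1 + (y e.2 - y e'.2)); lra.
by rewrite -hq addr_ge0.
Qed.

End Gradient.
End Pair.
End Weights.

(** * Convergence *)

Section Main.
Variable R : realType.
Local Notation C := R[i].

Lemma frob2_unitaryl p q (k : 'M[C]_p) (A : 'M[C]_(p, q)) : unitary k ->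
  frob2 (k *m A) = frob2 A.
Proof.
by move=> hk; rewrite -(frob2_unitary A hk (unitary1 _ q)) adj_mx1 mulmx1.
Qed.

Lemma frob2_unitaryr p q (k : 'M[C]_q) (A : 'M[C]_(p, q)) : unitary k ->
  frob2 (A *m invmx k) = frob2 A.
Proof.
move=> hk; have [_ uk] := mulmx1_unit hk.
have -> : invmx k = adj_mx k by rewrite -[RHS](mulmxK uk) hk mul1mx.
by rewrite -[RHS](frob2_unitary A (unitary1 _ p) hk) mul1mx.
Qed.

Lemma unitary_unit p (k : 'M[C]_p) : unitary k -> k \in unitmx.
Proof. by move/mulmx1_unit => []. Qed.

Lemma frob2_unitary_conj p q (k : 'M[C]_p) (l : 'M[C]_q) X (A : 'M[C]_(p, q)) Y :
  unitary k -> unitary l ->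
  frob2 (k *m X *m A *m (Y *m invmx l)) = frob2 (X *m A *m Y).
Proof.
move=> hk hl; rewrite (mulmxA (k *m X *m A) Y (invmx l)) (frob2_unitaryr _ hl).
by rewrite -(mulmxA k X A) -(mulmxA k (X *m A) Y) (frob2_unitaryl _ hk).
Qed.

Lemma rows_gt0 p q (M : 'M[C]_(p, q)) : M != 0 -> (0 < p)%N.
Proof. by case: p M => // M /eqP[]; exact: flatmx0. Qed.

Section Pair.
Variables (m n : nat) (G : set ('M[C]_m * 'M[C]_n)) (r1 : 'I_m -> 'I_m -> Prop)
  (r2 : 'I_n -> 'I_n -> Prop) (A : 'M[C]_(m, n)) (B : 'M[C]_(n, m)).
Hypotheses (sG : symmetric_subgroup G) (bG : block_structure G r1 r2)
  (A0 : A != 0) (B0 : B != 0).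

Lemma costAB_unitary k1 k2 g : unitary k1 -> unitary k2 -> GLpair g ->
  costAB A B (k1 *m g.1, k2 *m g.2) = costAB A B g.
Proof.
move=> h1 h2 [u1 u2]; have uk1 := unitary_unit h1; have uk2 := unitary_unit h2.
rewrite /costAB /= (invmx_mul uk1 u1) (invmx_mul uk2 u2) !ln_frob.
by rewrite !frob2_unitary_conj.
Qed.

(** The polar factor of [w] moves the eigenvalues, and the truncation is applied to [2 x_i + s] and
    [2 y_j], whose differences are exactly the exponents of the balanced sums. Each of the [m + n]
    new eigenvalues is at most [m + n] in absolute value, whence the cube. *)
Lemma cost_gap g w : G g -> G w -> exists T : 'M[C]_m * 'M[C]_n,
  [/\ iLieK G T, ip T T <= ((m + n) ^ 3)%:R &
   1 + ip (gradient G (costAB A B) g) T / 2 <=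
   expR (costAB A B (w.1 *m g.1, w.2 *m g.2) - costAB A B g)].
Proof.
move=> Gg Gw; have [[GL _ _ _] _ _] := sG; have gl := GL _ Gg.
have [k1 [k2 [H [hk1 hk2 HL e1 e2]]]] := polar sG bG Gw.
have [U [x [V [y [hU hV eH _]]]]] := iLieK_curve HL.
rewrite eH /= in e1 e2 HL.
have [sa sb] := wt_gt0 A0 B0 gl hU hV.
have -> : costAB A B (w.1 *m g.1, w.2 *m g.2) =
    logcost (wtA U V (base A B g).1) (wtB U V (base A B g).2) (drop_of x y).
  rewrite -(costAB_spec A B x y gl hU hV) e1 e2 (expmx_spec _ hU) (expmx_spec _ hV).
  rewrite -[k1 *m _ *m g.1]mulmxA -[k2 *m _ *m g.2]mulmxA.
  apply: (costAB_unitary (g := (_, _)) hk1 hk2); case: gl => u1 u2.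
  split; rewrite /= unitmx_mul ?u1 ?u2 andbT; apply: (spec_unit _ _).1 => // i;
    by rewrite lt0r_neq0 ?expR_gt0.
rewrite (costAB_base A B gl hU hV).
have [s hs] := logcost_gap (wtA_ge0 U V (base A B g).1) (wtB_ge0 U V (base A B g).2) sa sb (drop_of x y).
pose vals := codom (fun i : 'I_m => 2 * x i + s) ++ codom (fun j : 'I_n => 2 * y j).
have szv : size vals = (m + n)%N by rewrite size_cat !size_codom !card_ord.
have [tau [t0 tb te]] := potential_truncation vals.
have xv i : 2 * x i + s \in vals.
  by rewrite mem_cat (codom_f (fun i : 'I_m => 2 * x i + s)).
have yv j : 2 * y j \in vals.
  by rewrite mem_cat (codom_f (fun j : 'I_n => 2 * y j)) orbT.
pose tx i := tau (2 * x i + s); pose ty j := tau (2 * y j).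
have TL : iLieK G (spec U tx, spec V ty).
  (* The shifted function acts on the first component, where constants are allowed by reflexivity of
     [r1]; the one acting on the second fixes [0]. *)
  have [rr [_ tr1] [_ tr2] str] := bG; have /str[/= _ _ m1 m2] := HL.
  apply/str; split; [exact: spec_herm|exact: spec_herm| |].
    exact: (masked_spec (f := fun v => tau (2 * v + s)) tr1 rr hU m1).
  by apply: (masked_spec0 (f := fun v => tau (2 * v)) tr2 hV _ m2); rewrite mulr0.
exists (spec U tx, spec V ty); split=> //.
  rewrite ip_spec //.
  have b1 : \sum_i tx i ^+ 2 <= m%:R * (m + n)%:R ^+ 2.
    apply: le_trans (ler_sum _ (G := fun=> (m + n)%:R ^+ 2) _) _.
      by move=> i _; rewrite -szv; apply: tb.
    by rewrite sumr_const card_ord mulr_natl.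
  have b2 : \sum_j ty j ^+ 2 <= n%:R * (m + n)%:R ^+ 2.
    apply: le_trans (ler_sum _ (G := fun=> (m + n)%:R ^+ 2) _) _.
      by move=> i _; rewrite -szv; apply: tb.
    by rewrite sumr_const card_ord mulr_natl.
  have -> : ((m + n) ^ 3)%:R = m%:R * (m + n)%:R ^+ 2 + n%:R * (m + n)%:R ^+ 2 :> R.
    by rewrite -mulrDl -natrD -exprS natrX.
  exact: lerD.
have [_ hslope] := gradient_slope bG A0 B0 gl.
rewrite hslope //; apply: hs => e; rewrite /drop_of.
  by apply: le_trans (te _ _ (xv _) (yv _)) _; rewrite ler_expR; lra.
have := te _ _ (yv e.2) (xv e.1); rewrite -/(ty _) -/(tx _) => h.
apply: le_trans (_ : expR (2 * y e.2 - (2 * x e.1 + s)) <= _); first by lra.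
by rewrite ler_expR; lra.
Qed.

Lemma ip_young (D T : 'M[C]_m * 'M[C]_n) (l : R) : 0 < l ->
  - ip D T <= (l * ip D D + ip T T / l) / 2.
Proof.
move=> l0.
have hip p (M N : 'M[C]_p) : complex.Re (\tr (adj_mx M *m N)) =
    \sum_i \sum_j (complex.Re (M j i) * complex.Re (N j i) + complex.Im (M j i) * complex.Im (N j i)).
  rewrite /mxtrace cRe_sum; apply: eq_bigr => i _; rewrite mxE cRe_sum.
  apply: eq_bigr => j _; rewrite adj_mxE; case: (M j i) (N j i) => a b [c d] /=; ring.
have young p (M N : 'M[C]_p) : - complex.Re (\tr (adj_mx M *m N)) <=
   (l * complex.Re (\tr (adj_mx M *m M)) + complex.Re (\tr (adj_mx N *m N)) / l) / 2.
  rewrite !hip mulr_sumr mulr_suml -big_split mulr_suml -sumrN; apply: ler_sum => i _ /=.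
  rewrite mulr_sumr mulr_suml -big_split mulr_suml -sumrN; apply: ler_sum => j _ /=.
  have am (a b : R) : - (a * b) <= (l * (a * a) + b * b / l) / 2.
    rewrite ler_pdivlMr // -(ler_pM2r l0) mulrDl divfK ?lt0r_neq0 //.
    have := sqr_ge0 (l * a + b); lra.
  have := am (complex.Re (M j i)) (complex.Re (N j i)).
  have := am (complex.Im (M j i)) (complex.Im (N j i)).
  rewrite !mulrDl !mulrDr; lra.
rewrite /ip !cReD; have := young _ D.1 T.1; have := young _ D.2 T.2.
rewrite !mulrDl !mulrDr; lra.
Qed.

Lemma gd_in_G k : G (gd G A B (1 / 8) k).
Proof.
have [[GL G1 GM GV] _ _] := sG; elim: k => [//|k IH] /=.
have [[DL _] _] := gradient_slope bG A0 B0 (GL _ IH).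
exact: (GM _ _ (DL _) IH).
Qed.

Lemma kappa_at_gt0 g : GLpair g -> 0 < kappa_at A B g.
Proof.
move=> [u1 u2]; rewrite /kappa_at /kappaF.
have h p q (M : 'M[C]_(p, q)) : M != 0 -> 0 < frob M.
  by move=> M0; rewrite sqrtr_gt0; apply: frob2_gt0.
by rewrite mulr_gt0 //; apply: h; apply: unitmx_mul_neq0.
Qed.

Lemma costAB_kappa g : GLpair g -> costAB A B g = ln (kappa_at A B g).
Proof.
move=> [u1 u2]; rewrite /kappa_at /kappaF /costAB lnM // posrE.
all: by rewrite sqrtr_gt0; apply: frob2_gt0; apply: unitmx_mul_neq0.
Qed.

Lemma gradient_norm_ge g (eps : R) : G g -> 0 < kappa_star G A B -> 0 < eps -> eps < 1 / 2 ->
  eps <= ln (kappa_at A B g) - ln (kappa_star G A B) ->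
  eps ^+ 2 <= ((m + n) ^ 3)%:R *
    ip (gradient G (costAB A B) g) (gradient G (costAB A B) g).
Proof.
move=> Gg ks0 e0 e1 hgap; set D := gradient _ _ _; have [[GL G1 GM GV] _ _] := sG.
set ks := kappa_star G A B in ks0 hgap; set S := [set kappa_at A B h | h in G].
have infS : has_inf S.
  split; first by exists (kappa_at A B (1%:M, 1%:M)); exists (1%:M, 1%:M).
  by exists 0 => _ [h Gh <-]; apply/ltW/kappa_at_gt0/GL.
have d0 : 0 < ks * (eps / 24) by rewrite mulr_gt0 ?divr_gt0.
(* The infimum need not be attained, so the competitor is only optimal up to the factor
   [1 + eps / 24]. *)
have [_ [h Gh <-] hh] := inf_adherent d0 infS.
rewrite -/ks in hh.
have gl := GL _ Gg; have [u1 u2] := gl.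
have Gw : G (h.1 *m invmx g.1, h.2 *m invmx g.2) by apply: (GM _ _ Gh (GV _ Gg)).
have [T [_ TL' hT]] := cost_gap Gg Gw; move: hT.
rewrite /= !mulmxKV // -surjective_pairing -/D.
rewrite !costAB_kappa //; last exact: GL.
have kg0 := kappa_at_gt0 gl; have kh0 := kappa_at_gt0 (GL _ Gh).
have er (a b : R) : 0 < a -> 0 < b -> expR (ln a - ln b) = a / b.
  by move=> a0 b0; rewrite expRB !lnK ?posrE.
rewrite (er _ _ kh0 kg0) => hD.
have N0 : 0 < ((m + n) ^ 3)%:R :> R.
  by rewrite ltr0n expn_gt0 addn_gt0 (rows_gt0 A0).
exact: (norm_of_gap kg0 ks0 N0 e0 e1 hgap hh TL' hD (fun l => @ip_young D T l)).
Qed.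

Lemma ip_ge0 H : iLieK G H -> 0 <= ip H H.
Proof.
move=> /iLieK_curve[U [x [V [y [hU hV -> _]]]]]; rewrite ip_spec //.
by rewrite addr_ge0 // sumr_ge0 // => i _; apply: sqr_ge0.
Qed.

Local Notation grad k := (gradient G (costAB A B) (gd G A B (1 / 8) k)).

Lemma gd_step k :
  0 <= ip (grad k) (grad k) /\
  costAB A B (gd G A B (1 / 8) k.+1) <=
    costAB A B (gd G A B (1 / 8) k) - ip (grad k) (grad k) / 40.
Proof.
have [[GL _ _ _] _ _] := sG; have gl := GL _ (gd_in_G k).
have [DL _] := gradient_slope bG A0 B0 gl; split; first exact: ip_ge0.
exact: (gradient_step_descent bG A0 B0 gl).
Qed.

Lemma gd_convergence (eps : R) (T : nat) : 0 < kappa_star G A B -> 0 < eps -> eps < 1 / 2 ->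
  320 * Num.max (m ^ 3)%:R (n ^ 3)%:R * ln (kappaF A B / kappa_star G A B) / eps ^+ 2 <= T%:R ->
  ln (kappa_at A B (gd G A B (1 / 8) T)) - ln (kappa_star G A B) < eps.
Proof.
move=> ks0 e0 e1 hT; have [[GL _ _ _] _ _] := sG.
have m1 := rows_gt0 A0.
pose f k := costAB A B (gd G A B (1 / 8) k).
have fE k : f k = ln (kappa_at A B (gd G A B (1 / 8) k)) by apply/costAB_kappa/GL/gd_in_G.
have f0 : kappa_at A B (gd G A B (1 / 8) 0) = kappaF A B.
  by rewrite /= /kappa_at /= !invmx1 !mul1mx !mulmx1.
rewrite -fE; apply: (@descent_rate _ f (fun k => ip (grad k) (grad k)) (Num.max (m ^ 3)%:R (n ^ 3)%:R)).
- by rewrite lt_max ltr0n expn_gt0 m1.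
- exact: e0.
- by move=> k; have [_] := gd_step k.
- by move=> k; have [] := gd_step k.
- move=> k; rewrite fE => hk.
  apply: le_trans (gradient_norm_ge (gd_in_G k) ks0 e0 e1 hk) _.
  apply: ler_wpM2r; first by have [] := gd_step k.
  (* Since [m + n] is at most twice the maximum, its cube is at most [8] times the larger cube. *)
  have [mn|mn] := leqP m n.
    apply: le_trans (_ : 8 * (n ^ 3)%:R <= _).
      by rewrite -natrM ler_nat -(expnMn 2 n 3) leq_exp2r // mul2n -addnn leq_add2r.
    by rewrite ler_pM2l // le_max lexx orbT.
  apply: le_trans (_ : 8 * (m ^ 3)%:R <= _).
    by rewrite -natrM ler_nat -(expnMn 2 m 3) leq_exp2r // mul2n -addnn leq_add2l ltnW.
  by rewrite ler_pM2l // le_max lexx.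
rewrite fE f0 -ln_div ?posrE // -f0.
exact: (kappa_at_gt0 (GL _ (gd_in_G 0))).
Qed.

End Pair.
End Main.

Theorem mainTheorem5 (R : realType) :
  exists c : R, 0 < c /\
  forall (m n : nat) (G : set ('M[R[i]]_m * 'M[R[i]]_n))
         (A : 'M[R[i]]_(m, n)) (B : 'M[R[i]]_(n, m)),
    symmetric_subgroup G ->
    ((* case (i) *)
     (forall D E, torus D -> torus E -> G (D, E)) \/
     (* case (ii): G identified with G x {I_n} *)
     ((forall D, torus D -> G (D, 1%:M)) /\ (forall g, G g -> g.2 = 1%:M))) ->
    A != 0 -> B != 0 ->
    0 < kappa_star G A B ->
    forall eps : R, 0 < eps -> eps < 1 / 2 ->
    forall T : nat,
      c * (Num.max (m ^ 3)%:R (n ^ 3)%:R)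
        * ln (kappaF A B / kappa_star G A B) / eps ^+ 2 <= T%:R ->
      ln (kappa_at A B (gd G A B (1 / 8) T)) - ln (kappa_star G A B) < eps.
Proof.
(* The value is [40 * 8]: [40] from the descent of one step, [8] from comparing the cube of [m + n]
   with the larger of the two cubes. *)
exists 320; split=> [|m n G A B sG cases A0 B0 ks0 eps e0 e1 T hT]; first exact: ltr0n.
have [r1 [r2 bG]] := symmetric_blocks sG cases.
exact: (gd_convergence sG bG A0 B0 ks0 e0 e1 hT).
Qed.
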